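(* Let $(X,d,\mu,\mathcal{E},\mathcal{F})$ be a Dirichlet space satisfying the standing assumptions (A1)–(A3), (HK), (BE) stated in the context, and let $0<\delta<1$. For $2\le p<\infty$, $\mathbf{B}^{p,1/p}(X)=\mathcal{W}^{\delta d_W/p,\,p}(X)$ is dense in $L^p(X,\mu)$.
   Context: Setting. $(X,d,\mu)$ is a locally compact metric measure space, $\mu$ a Radon measure supported on $X$, and $(\mathcal{E},\mathcal{F})$ is a Dirichlet form on $L^2(X,\mu)$ with heat semigroup $\{P_t\}_{t>0}$ and generator $L$. Write $B(x,r)=\{y: d(x,y)<r\}$. For $\lambda>0$, $1\le p<\infty$, $KS^{\lambda,p}(X)$ is the set of $f\in L^p(X,\mu)$ with $\limsup_{r\to0^+}\int_X\int_{B(x,r)}\frac{|f(x)-f(y)|^p}{r^{\lambda p}\mu(B(x,r))}d\mu(y)d\mu(x)<\infty$. Standing assumptions. (A1) Every ball $B(x,r)$ has compact closure. (A2) There are $c_1,c_2,d_H>0$ with $c_1r^{d_H}\le\mu(B(x,r))\le c_2r^{d_H}$ for all $x\in X$, $r\ge0$. (A3) $(\mathcal{E},\mathcal{F})$ is regular and strongly local. (HK) $\{P_t\}$ has a continuous heat kernel $p_t(x,y)$ and there are $c_3,c_4,c_5,c_6\in(0,\infty)$, $d_W\in[2,\infty)$ with $c_5t^{-d_H/d_W}\exp(-c_6(d(x,y)^{d_W}/t)^{1/(d_W-1)})\le p_t(x,y)\le c_3t^{-d_H/d_W}\exp(-c_4(d(x,y)^{d_W}/t)^{1/(d_W-1)})$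 for $\mu\times\mu$-a.e. $(x,y)$ and every $t>0$. (BE) There is $C>0$ such that $|P_tg(x)-P_tg(y)|\le C\frac{d(x,y)^\kappa}{t^{\kappa/d_W}}\|g\|_{L^\infty(X,\mu)}$ for all $t>0$, $g\in L^\infty(X,\mu)$, $x,y\in X$, where $0<\kappa<d_W$ is defined by $d_W-\kappa=\sup\{\lambda>0: KS^{\lambda,1}(X)\text{ contains non-constant functions}\}$. Subordinated semigroup. For fixed $0<\delta<1$ let $\eta^{(\delta)}_t\ge0$ be the continuous function with $\int_0^\infty\eta^{(\delta)}_t(s)e^{-s\lambda}ds=e^{-t\lambda^\delta}$ for $\lambda>0$. The semigroup with generator given by the fractional Laplacian $(-L)^\delta$ is $P^{(\delta)}_tf=\int_0^\infty\eta^{(\delta)}_t(s)P_sf\,ds$, with heat kernel $p^{(\delta)}_t(x,y)=\int_0^\infty\eta^{(\delta)}_t(s)p_s(x,y)ds$. Besov classes. For $p\ge1$, $\alpha\ge0$: $\|f\|_{p,\alpha}=\sup_{t>0}t^{-\alpha}\left(\int_X\int_X|f(x)-f(y)|^pp^{(\delta)}_t(x,y)d\mu(x)d\mu(y)\right)^{1/p}$ and $\mathbf{B}^{p,\alpha}(X)=\{f\in L^p(X,\mu):\|f\|_{p,\alpha}<\infty\}$. Fractional Sobolev spaces. $W_{\lambda,p}(f)=\left(\int_X\int_X\frac{|f(x)-f(y)|^p}{d(x,y)^{d_H+\lambda p}}d\mu(y)d\mu(x)\right)^{1/p}$ and $\mathcal{W}^{\lambda,p}(X)=\{f\in L^p(X,\mu):W_{\lambda,p}(f)<\infty\}$.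 *)

(* Defs.v *)
From HB Require Import structures.
From mathcomp Require Import all_boot all_order all_algebra.
From mathcomp Require Import all_classical all_reals all_analysis.

Set Implicit Arguments.
Unset Strict Implicit.
Unset Printing Implicit Defensive.

Import Order.TTheory GRing.Theory Num.Theory.
Import numFieldNormedType.Exports.

Local Open Scope classical_set_scope.
Local Open Scope ring_scope.

HB.mixin Record Metric_isBorel (d : measure_display) (R : realType) T
  & Measurable d T & Metric R T := {
  measurable_borel : (@measurable d T : set (set T)) = <<s [set U : set T | open U] >>
}.

#[short(type="borelMetricType")]
HB.structure Definition BorelMetric (d : measure_display) (R : realType) :=
  { T of Measurable d T & Metric R T & Metric_isBorel d R T }.

Section metric_measure.
Context (d : measure_display) (R : realType) (X : borelMetricType d R).
Variable mu : {measure set X -> \bar R}.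
Implicit Types (f g h u v : X -> R).

Definition radon : Prop :=
  [/\ forall K : set X, compact K -> (mu K < +oo)%E,
      forall A : set X, measurable A ->
        mu A = ereal_inf [set mu U | U in [set U | open U /\ A `<=` U]]
    & forall U : set X, open U ->
        mu U = ereal_sup [set mu K | K in [set K | compact K /\ K `<=` U]]].

Definition full_support : Prop :=
  forall U : set X, open U -> U !=set0 -> (0 < mu U)%E.

(** Elements of the [L^p] spaces are represented by measurable functions, and
    identities between elements are stated almost everywhere. *)
Definition inner2 f g : R := \int[mu]_x (f x * g x).

Definition Lp_dense (p : R) (A : set (X -> R)) : Prop :=
  forall g, g \in Lfun mu p%:E -> forall e : R, 0 < e ->
    exists2 f, A f & ('N[mu]_p%:E[EFin \o (g \- f)%R] < e%:E)%E.

(** The support of the measure [f mu], which only depends on the a.e. class. *)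
Definition ess_support f : set X :=
  [set x | forall U : set X, open U -> U x ->
             ~ mu.-negligible (U `&` [set y | f y != 0])].

Definition Cc : set (X -> R) :=
  [set f | continuous f /\ compact (closure [set x | f x != 0])].

Section dirichlet_form.
Variables (E : (X -> R) -> (X -> R) -> R) (F : set (X -> R)).

Definition form1 f : R := E f f + inner2 f f.

(** A symmetric Dirichlet form with domain [F]; only the values of [E] on
    [F * F] are meaningful. *)
Record dirichlet_form : Prop := {
  form_domain_L2 : forall f, F f -> f \in Lfun mu 2%:E;
  form_domain_ae : forall f g, F f -> measurable_fun setT g ->
    f = g %[ae mu] -> F g;
  form_domain0 : F (cst 0);
  form_domain_lin : forall (a : R) f g, F f -> F g ->
    F (fun x => a * f x + g x);
  form_domain_dense : Lp_dense 2 F;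
  form_ae : forall f g h, F f -> F g -> F h ->
    f = g %[ae mu] -> E f h = E g h;
  form_lin : forall (a : R) f g h, F f -> F g -> F h ->
    E (fun x => a * f x + g x) h = a * E f h + E g h;
  form_sym : forall f g, F f -> F g -> E f g = E g f;
  form_ge0 : forall f, F f -> 0 <= E f f;
  form_closed : forall u_ : nat -> X -> R, (forall n, F (u_ n)) ->
    (forall e : R, 0 < e -> exists N : nat, forall m n : nat,
       (N <= m)%N -> (N <= n)%N -> form1 (u_ m \- u_ n) < e) ->
    exists2 u, F u & form1 (u_ n \- u) @[n --> \oo] --> 0;
  form_markov : forall u, F u ->
    let v := fun x => Num.min (Num.max (u x) 0) 1 in
    F v /\ E v v <= E u u
}.

Definition regular_form : Prop :=
  (forall f, F f -> forall e : R, 0 < e ->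
     exists2 g, F g /\ Cc g & form1 (f \- g) < e) /\
  (forall f, Cc f -> forall e : R, 0 < e ->
     exists2 g, F g /\ Cc g & forall x, `|f x - g x| < e).

Definition strongly_local_form : Prop :=
  forall u v, F u -> F v ->
    compact (ess_support u) -> compact (ess_support v) ->
    forall (U : set X) (c : R), open U -> ess_support v `<=` U ->
      (\forall x \ae mu, U x -> u x = c) -> E u v = 0.

(** [L f = h] for the operator [L] associated with the form by
    [E f g = - <L f, g>] for all [g] in [F]. *)
Definition form_generator f h : Prop :=
  [/\ F f, h \in Lfun mu 2%:E & forall g, F g -> E f g = - inner2 h g].

Section semigroup.
Variable P : R -> (X -> R) -> (X -> R).

Record L2_semigroup : Prop := {
  sg_L2 : forall (t : R) f, 0 < t -> f \in Lfun mu 2%:E -> P t f \in Lfun mu 2%:E;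
  sg_ae : forall (t : R) f g, 0 < t -> f \in Lfun mu 2%:E -> g \in Lfun mu 2%:E ->
    f = g %[ae mu] -> P t f = P t g %[ae mu];
  sg_lin : forall (t a : R) f g, 0 < t ->
    f \in Lfun mu 2%:E -> g \in Lfun mu 2%:E ->
    \forall x \ae mu, P t (fun y => a * f y + g y) x = a * P t f x + P t g x;
  sg_sym : forall (t : R) f g, 0 < t -> f \in Lfun mu 2%:E -> g \in Lfun mu 2%:E ->
    inner2 (P t f) g = inner2 f (P t g);
  sg_contraction : forall (t : R) f, 0 < t -> f \in Lfun mu 2%:E ->
    ('N[mu]_2%:E[EFin \o P t f] <= 'N[mu]_2%:E[EFin \o f])%E;
  sg_add : forall (s t : R) f, 0 < s -> 0 < t -> f \in Lfun mu 2%:E ->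
    P (s + t) f = P s (P t f) %[ae mu];
  sg_continuous : forall f, f \in Lfun mu 2%:E ->
    ('N[mu]_2%:E[EFin \o (P t f \- f)%R])%E @[t --> 0^'+] --> 0%E
}.

(** [L f = h] for the infinitesimal generator [L] of [P]. *)
Definition sg_generator f h : Prop :=
  [/\ f \in Lfun mu 2%:E, h \in Lfun mu 2%:E &
    ('N[mu]_2%:E[EFin \o (fun x => (P t f x - f x) / t - h x)%R])%E
      @[t --> 0^'+] --> 0%E].

Definition heat_semigroup : Prop :=
  L2_semigroup /\ forall f h, sg_generator f h <-> form_generator f h.

End semigroup.
End dirichlet_form.

(** The Korevaar-Schoen class; [mu (ball x r)] is finite since balls are
    relatively compact, so [fine] loses nothing. *)
Definition KS (lambda p : R) : set (X -> R) :=
  [set f | f \in Lfun mu p%:E /\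
    (limf_esup (fun r : R => \int[mu]_x \int[mu]_(y in ball x r)
        (`|f x - f y| `^ p / (r `^ (lambda * p) * fine (mu (ball x r))))%:E)
      0^'+ < +oo)%E].

Definition ae_constant f : Prop := exists c : R, \forall x \ae mu, f x = c.

Definition ahlfors_regular (dH : R) : Prop :=
  0 < dH /\ exists c1 c2 : R, [/\ 0 < c1, 0 < c2 &
    forall (x : X) (r : R), 0 <= r ->
      ((c1 * r `^ dH)%:E <= mu (ball x r) <= (c2 * r `^ dH)%:E)%E].

Section heat_kernel.
Variable pt : R -> X -> X -> R.

(** For bounded [g] this is the extension of the heat semigroup to
    [L^infinity], in its pointwise defined version. *)
Definition kernel_op (t : R) (g : X -> R) (x : X) : R :=
  \int[mu]_y (pt t x y * g y).

Definition continuous_heat_kernel (P : R -> (X -> R) -> (X -> R)) : Prop :=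
  forall t : R, 0 < t ->
    continuous (fun z : X * X => pt t z.1 z.2) /\
    forall f, f \in Lfun mu 2%:E -> P t f = kernel_op t f %[ae mu].

Definition sub_gaussian_bounds (dH dW : R) : Prop :=
  2 <= dW /\ exists c3 c4 c5 c6 : R,
    [/\ 0 < c3, 0 < c4, 0 < c5, 0 < c6 &
      forall t : R, 0 < t -> \forall z \ae (mu \x mu)%E,
        c5 * t `^ (- (dH / dW)) *
          expR (- (c6 * (mdist z.1 z.2 `^ dW / t) `^ (dW - 1)^-1))
        <= pt t z.1 z.2 <=
        c3 * t `^ (- (dH / dW)) *
          expR (- (c4 * (mdist z.1 z.2 `^ dW / t) `^ (dW - 1)^-1))].

(** [kappa] is determined by [dW - kappa] being the critical exponent of the
    Korevaar-Schoen classes for [p = 1]. *)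
Definition weak_bakry_emery (dW kappa : R) : Prop :=
  [/\ 0 < kappa, kappa < dW,
    (dW - kappa)%:E = ereal_sup [set lambda%:E | lambda in
      [set lambda : R | 0 < lambda /\
         exists2 f, KS lambda 1 f & ~ ae_constant f]] &
    exists2 C : R, 0 < C & forall (t : R) g, 0 < t -> g \in Lfun mu +oo%E ->
      forall x y : X,
        (`|kernel_op t g x - kernel_op t g y|%:E <=
         (C * (mdist x y `^ kappa / t `^ (kappa / dW)))%:E *
           'N[mu]_+oo[EFin \o g])%E].

Definition subordinated_kernel (eta : R -> R -> R) (t : R) (x y : X) : \bar R :=
  (\int[lebesgue_measure]_(s in `]0%R, +oo[) (eta t s * pt s x y)%:E)%E.

Definition besov_norm (eta : R -> R -> R) (p alpha : R) f : \bar R :=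
  ereal_sup [set ((t `^ (- alpha))%:E *
      (\int[mu]_y \int[mu]_x
        ((`|f x - f y| `^ p)%:E * subordinated_kernel eta t x y)) `^ p^-1)%E
    | t in [set t : R | 0 < t]].

Definition besov (eta : R -> R -> R) (p alpha : R) : set (X -> R) :=
  [set f | f \in Lfun mu p%:E /\ (besov_norm eta p alpha f < +oo)%E].

End heat_kernel.

(** On the diagonal the integrand evaluates to 0; the diagonal is
    negligible under [ahlfors_regular]. *)
Definition sobolev_seminorm (dH lambda p : R) f : \bar R :=
  ((\int[mu]_x \int[mu]_y
     (`|f x - f y| `^ p / mdist x y `^ (dH + lambda * p))%:E) `^ p^-1)%E.

Definition sobolev (dH lambda p : R) : set (X -> R) :=
  [set f | f \in Lfun mu p%:E /\ (sobolev_seminorm dH lambda p f < +oo)%E].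

End metric_measure.

(** [eta t] is the density at time [t] of the [delta]-stable subordinator; it
    is determined on the positive half-line by its Laplace transform. *)
Definition stable_subordinator_density (R : realType) (delta : R)
    (eta : R -> R -> R) : Prop :=
  forall t : R, 0 < t ->
    [/\ {in `]0, +oo[, continuous (eta t)},
        forall s : R, 0 < s -> 0 <= eta t s &
        forall lambda : R, 0 < lambda ->
          (\int[lebesgue_measure]_(s in `]0%R, +oo[)
             (eta t s * expR (- (s * lambda)))%:E)%E =
          (expR (- (t * lambda `^ delta)))%:E].

(* Main.v *)
Require Import Defs.
From HB Require Import structures.
From mathcomp Require Import all_boot all_order all_algebra finmap.
From mathcomp Require Import all_classical all_reals all_analysis.
From mathcomp Require Import ring lra measurable_realfun.

Set Implicit Arguments.
Unset Strict Implicit.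
Unset Printing Implicit Defensive.

Import Order.TTheory GRing.Theory Num.Theory.
Import numFieldNormedType.Exports.

Local Open Scope classical_set_scope.
Local Open Scope ring_scope.

(** Both claims rest on a two-sided comparison of the subordinated kernel with the
jump kernel of the fractional Sobolev seminorm.  With [r = mdist x y] and off the
diagonal, [p^(delta)_t(x,y) <= C t / r^(dH + delta dW)] for every [t > 0], and the
reverse bound, with another constant, holds as soon as [t <= r^(delta dW)]
([subordinated_kernel_le], [subordinated_kernel_ge]).  By the upper bound the
Besov energy at time [t] is at most [C t] times the Sobolev energy.  Conversely,
the pairs with [t <= r^(delta dW)] contribute to the Besov energy at time [t] at
least a multiple of [t] times their Sobolev energy, and letting [t] decrease to 0
recovers the whole Sobolev energy by monotone convergence.
This gives [besov_eq_sobolev].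

The kernel bounds come from the Laplace transform of the subordinator density.
In the variable [u = s / r^dW] the sub-Gaussian bounds are powers of [r] times
functions [u^(-a) exp (- c u^(-b))].  Such a function is at most a multiple of
[1 - exp (- u)], and at least a multiple of a combination of four exponentials
that is integrated exactly ([subordinated_stretched_le],
[subordinated_stretched_ge]).

For the density, truncate [g] in [L^p] to a function [f] bounded by [M] and
supported in a ball, and let [u = (1 - h L)^-1 f].  As [h] tends to 0, [u] tends to
[f] in [L^2].  By the Markov property [u] is again bounded by [M], and
[|u - f|^p <= (2 M)^(p-2) |u - f|^2] as [p >= 2], so [u] also tends to [f] in [L^p].
It remains to see that [u] lies in the Sobolev class ([bounded_energy_sobolev]).
Since [u] is in the domain of [L],
  [iint (u x - u y)^2 p_t(x,y) <= 2 <u - P_t u, u> <= C min (t, 1)]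
([generator_energy_le]).  On the pairs with [r / 2 < mdist x y <= r] the heat
kernel at time [r^dW] is at least a multiple of [r^(-dH)], so the Sobolev energy of
[u] over these pairs is at most [C' r^(- delta dW) min (r^dW, 1)].  As
[0 < delta < 1], the sum over the dyadic [r] is finite.

The energy inequality uses that [P_t] is sub-Markov.  This is deduced from the
Markov property of the form: each resolvent [(1 - h L)^-1] preserves the functions
with values in [[0, 1]], and so does [P_t], being a limit of iterated resolvents
([heat_sub_markov]). *)

(** * Partial integrals and Borel sets of the product space *)

Section integral_nomeas.
Context d (T : measurableType d) (R : realType).
Variable mu : {measure set T -> \bar R}.
Local Open Scope ereal_scope.
Import HBNNSimple.

(** The integral of a nonnegative function is a supremum over the simple functions
below it, so monotonicity holds for arbitrary integrands.  It is applied
to the subordinated kernel, whose measurability in the space variables is not at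
hand. *)
Lemma ge0_le_integral_lower (D : set T) (f g : T -> \bar R) :
  (forall x, D x -> 0 <= f x) -> (forall x, D x -> f x <= g x) ->
  \int[mu]_(x in D) f x <= \int[mu]_(x in D) g x.
Proof.
move=> f0 fg.
have g0 x : D x -> 0 <= g x by move=> Dx; exact: le_trans (f0 _ Dx) (fg _ Dx).
rewrite !ge0_integralE //; apply: le_ereal_sup => _ [h hf <-].
exists h => // x; apply: le_trans (hf x) _.
by rewrite /patch; case: ifP => // /set_mem; exact: fg.
Qed.

Lemma ge0_integralZl_lower (D : set T) (f : T -> \bar R) (k : R) :
  (0 < k)%R -> (forall x, D x -> 0 <= f x) ->
  \int[mu]_(x in D) (k%:E * f x) = k%:E * \int[mu]_(x in D) f x.
Proof.
have le1 (l : R) (g : T -> \bar R) : (0 < l)%R -> (forall x, D x -> 0 <= g x) ->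
    l%:E * \int[mu]_(x in D) g x <= \int[mu]_(x in D) (l%:E * g x).
  move=> l0 g0; rewrite !ge0_integralE //; last first.
    by move=> x Dx; rewrite mule_ge0 ?g0 // lee_fin ltW.
  rewrite -ereal_sup_pZl //; apply: le_ereal_sup => _ [_ [h hg <-] <-].
  exists (scale_nnsfun h (ltW l0)); last by rewrite sintegralrM.
  move=> x /=; rewrite EFinM; have := hg x; rewrite /patch.
  case: ifP => _ hx; last by rewrite -(@lee_pmul2l _ l%:E) // mule0 in hx.
  by rewrite lee_pmul2l.
move=> k0 f0; apply/eqP; rewrite eq_le le1 // andbT.
have kV : (0 < k^-1)%R by rewrite invr_gt0.
rewrite -(@lee_pmul2l _ k^-1%:E) // muleA -EFinM mulVf ?gt_eqF // mul1e.
apply: le_trans (le1 _ _ kV _) _ => [x Dx|].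
  by rewrite mule_ge0 ?f0 // lee_fin ltW.
under eq_integral do rewrite muleA -EFinM mulVf ?gt_eqF // mul1e.
exact: lexx.
Qed.

End integral_nomeas.

Section product_borel.
Context (d : measure_display) (R : realType) (X : borelMetricType d R).
Hypothesis rel_compact : forall (x : X) (r : R), compact (closure (ball x r)).

Lemma open_borel (U : set X) : open U -> measurable U.
Proof. by move=> oU; rewrite measurable_borel; exact: sub_sigma_algebra. Qed.

Lemma open_ball_metric (x : X) (r : R) : open (ball x r).
Proof.
rewrite openE => y xy; rewrite /interior; move: (xy); rewrite ballEmdist /= => xyr.
have e0 : 0 < r - mdist x y by rewrite subr_gt0.
apply/nbhs_ballP; exists (r - mdist x y) => //= z; rewrite !ballEmdist /= => yz.
by rewrite (le_lt_trans (metric_triangle x y z)) // -ltrBrDl.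
Qed.

Lemma ball_borel (x : X) r : measurable (ball x r).
Proof. by apply: open_borel; exact: open_ball_metric. Qed.

(** Relatively compact balls make the space separable: each ball with an integer
radius has a finite net of every mesh [1 / m.+1]. *)
Lemma exists_dense_sequence (x0 : X) : exists q : nat -> X,
  forall (x : X) (e : R), 0 < e -> exists n, mdist x (q n) < e.
Proof.
have cov (n m : nat) : exists D : {fset X}, closure (ball x0 n%:R) `<=`
    cover [set` D] (fun q => ball q m.+1%:R^-1).
  have := @rel_compact x0 n%:R; rewrite compact_cover => /(_ X setT
    (fun q => (ball q m.+1%:R^-1)°)) [].
  - by move=> i _; exact: open_interior.
  - move=> y _; exists y => //; by apply: nbhsx_ballx; rewrite invr_gt0.
  move=> D _ cD; exists D; apply: subset_trans cD _ => y [q Dq yq].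
  by exists q => //; exact: interior_subset yq.
have [D DP] : {D : nat -> nat -> {fset X} | forall n m, closure (ball x0 n%:R)
   `<=` cover [set` D n m] (fun q => ball q m.+1%:R^-1)}.
  exists (fun n m => sval (cid (cov n m))) => n m; exact: svalP (cid (cov n m)).
pose Q := \bigcup_n \bigcup_m [set` D n m].
have cQ : countable Q.
  apply: bigcup_countable => // n _; exact: bigcup_countable.
have /countable_injP[f finj] := cQ.
pose g (n : nat) := if pselect (exists2 y, Q y & f y = n) is left h
  then s2val (cid2 h) else x0.
exists g => x e e0.
pose n := (Num.truncn (mdist x0 x)).+1; pose m := Num.truncn e^-1.
have xn : closure (ball x0 n%:R) x.
  apply: subset_closure; rewrite ballEmdist /=.
  by rewrite /n real_truncnS_gt ?num_real.
have [y Dy xy] := DP n m x xn.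
have Qy : Q y by exists n => //; exists m.
exists (f y); rewrite /g; case: pselect => [h|]; last by case; exists y.
case: cid2 => z Qz fz /=; have -> : z = y by apply: finj => //; exact/mem_set.
rewrite metric_sym; move: xy; rewrite ballEmdist /= => /lt_trans; apply.
by rewrite invf_plt ?posrE // /m real_truncnS_gt ?num_real.
Qed.

(** Separability is what makes the product sigma-algebra contain the open sets of
the product: an open set is the union of the products of two balls of the same
radius [1 / m.+1], centred in the dense sequence, that it contains. *)
Lemma open_product_borel (O : set (X * X)) : open O -> measurable O.
Proof.
move=> oO; have [->|/set0P[[x0 _] _]] := eqVneq O set0; first exact: measurable0.
have [q qd] := exists_dense_sequence x0.
pose rect (i : nat * nat * nat) := ball (q i.1.1) i.2.+1%:R^-1 `*`
   ball (q i.1.2) i.2.+1%:R^-1.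
pose F i := if pselect (rect i `<=` O) then rect i else set0.
have -> : O = \bigcup_i F i.
  apply/seteqP; split => [[x y] Oxy|z [i _]]; last first.
    by rewrite /F; case: pselect => // s /s.
  have : nbhs (x, y) O by apply: open_nbhs_nbhs.
  case=> -[A B] [/= /nbhs_ballP[a /= a0 aA] /nbhs_ballP[b /= b0 bB]] AB.
  pose e := Num.min a b / 2.
  have e0 : 0 < e by rewrite divr_gt0 // lt_min a0.
  pose m := Num.truncn e^-1.
  have me : m.+1%:R^-1 < e by rewrite invf_plt ?posrE // real_truncnS_gt ?num_real.
  have [i qi] := qd x m.+1%:R^-1 (ltac:(by rewrite invr_gt0)).
  have [j qj] := qd y m.+1%:R^-1 (ltac:(by rewrite invr_gt0)).
  exists ((i, j), m) => //; rewrite /F; case: pselect => [rO|].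
    by split; rewrite /= ballEmdist /= metric_sym.
  case=> -[u v] [/=]; rewrite !ballEmdist /= => qu qv; apply: AB; split => /=.
    apply: aA; rewrite ballEmdist /= (le_lt_trans (metric_triangle _ (q i) _)) //.
    rewrite (@lt_le_trans _ _ (e + e)) ?ltrD // ?(lt_trans qi) ?(lt_trans qu) //.
    by rewrite -splitr ge_min lexx.
  apply: bB; rewrite ballEmdist /= (le_lt_trans (metric_triangle _ (q j) _)) //.
  rewrite (@lt_le_trans _ _ (e + e)) ?ltrD // ?(lt_trans qj) ?(lt_trans qv) //.
  by rewrite -splitr ge_min lexx orbT.
apply: countable_bigcupT_measurable => // i; rewrite /F.
case: pselect => s /=; last exact: measurable0.
by apply: measurableX; exact: ball_borel.
Qed.

Lemma continuous_product_borel (f : X * X -> R) :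
  continuous f -> measurable_fun setT f.
Proof.
move=> cf; apply: (measurability _ (RGenOpens.measurableE R)).
move=> _ [_ [a [b ->] <-]]; rewrite setTI; apply: open_product_borel.
by apply: open_comp => // x _; exact: cf.
Qed.

Lemma mdist_continuous : continuous (fun z : X * X => mdist z.1 z.2).
Proof.
move=> [x y]; apply/cvgrPdist_lt => e e0.
exists (ball x (e / 2), ball y (e / 2)).
  by split; apply: nbhsx_ballx; rewrite divr_gt0.
move=> [u v] [/=]; rewrite !ballEmdist /= => xu yv.
have h1 := metric_triangle x u y; have h2 := metric_triangle u v y.
have h3 := metric_triangle u x v; have h4 := metric_triangle x y v.
have := metric_sym v y; have := metric_sym u x => e1 e2.
rewrite ltr_norml; apply/andP; split; lra.
Qed.

End product_borel.

Section sections_integral.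
Context d d' (T : measurableType d) (T' : measurableType d') (R : realType).
Variable mu : {measure set T -> \bar R}.
Hypothesis sfmu : sigma_finite setT mu.

Let nu : set T -> \bar R := mu.
HB.instance Definition _ := Measure.copy nu mu.
HB.instance Definition _ := @Measure_isSigmaFinite.Build _ _ _ nu sfmu.

(** Sigma-finiteness is an assumption on [mu], whereas Tonelli's theorem expects it
as part of the structure of the measure; the copy [nu] of [mu] carries it. *)
Lemma measurable_integral_section (f : T' * T -> \bar R) :
  measurable_fun setT f -> (forall z, 0 <= f z)%E ->
  measurable_fun setT (fun x => \int[mu]_y f (x, y))%E.
Proof.
move=> mf f0.
exact: (@measurable_fun_fubini_tonelli_F _ _ T' T R nu f mf f0).
Qed.

End sections_integral.

Section double_integral_limit.
Context d (T : measurableType d) (R : realType).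
Variable mu : {measure set T -> \bar R}.
Hypothesis sfmu : sigma_finite setT mu.
Local Open Scope ereal_scope.

(** Monotone convergence applied to both integrals. *)
Lemma double_integral_le_limit (F : nat -> T * T -> \bar R) (f : T * T -> \bar R)
    (M : \bar R) :
  (forall n, measurable_fun setT (F n)) -> (forall n z, 0 <= F n z) ->
  (forall z, {homo F ^~ z : n m / (n <= m)%N >-> n <= m}) ->
  (forall z, F n z @[n --> \oo] --> f z) ->
  (forall n, \int[mu]_x \int[mu]_y F n (x, y) <= M) ->
  \int[mu]_x \int[mu]_y f (x, y) <= M.
Proof.
move=> mF F0 ndF Ff FM.
have -> : \int[mu]_x \int[mu]_y f (x, y) =
    \int[mu]_x limn (fun n => \int[mu]_y F n (x, y)).
  apply: eq_integral => x _; rewrite -monotone_convergence //.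
  - by apply: eq_integral => y _; apply/esym/cvg_lim => //; exact: Ff.
  - by move=> n; apply: measurableT_comp => //.
rewrite monotone_convergence //.
- apply: lime_le; last exact: nearW.
  apply: ereal_nondecreasing_is_cvgn => n m nm.
  apply: ge0_le_integral_lower => x _; first exact: integral_ge0.
  by apply: ge0_le_integral_lower => y _ //; exact: ndF.
- by move=> n; exact: measurable_integral_section.
- by move=> n x _; exact: integral_ge0.
- move=> x _ n m nm; apply: ge0_le_integral_lower => y _ //; exact: ndF.
Qed.

End double_integral_limit.

(** * Membership in the Lebesgue spaces *)

Section Lfun_facts.
Context d (T : measurableType d) (R : realType).
Variable mu : {measure set T -> \bar R}.

Lemma Lfun_measurable (p : \bar R) (f : T -> R) :
  f \in Lfun mu p -> measurable_fun setT f.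
Proof. by rewrite inE => /andP[/[!inE]/=]. Qed.

Lemma mem_LfunP (p : R) (f : T -> R) : 0 < p -> measurable_fun setT f ->
  f \in Lfun mu p%:E <-> (\int[mu]_x (`|f x| `^ p)%:E < +oo)%E.
Proof.
move=> p0 mf; have e : (\int[mu]_x (`|f x| `^ p)%:E = 'N[mu]_p%:E[EFin \o f] `^ p)%E.
  by rewrite poweR_Lnorm ?gt_eqF //; apply: eq_integral.
rewrite e; split; first by rewrite inE => /andP[_ /[!inE]/= h]; exact: poweR_lty.
move=> /lty_poweRy h; rewrite inE; apply/andP; split; rewrite inE //=.
by apply: h; rewrite gt_eqF.
Qed.

End Lfun_facts.

(** * Stretched exponentials *)

Local Opaque expR powR.
Section stretched_exponential.
Variable R : realType.
Implicit Types a b c u D s t : R.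

Lemma powR_inv (x r : R) : 0 < x -> x^-1 `^ r = x `^ (- r).
Proof. by move=> x0; rewrite -powR_inv1 ?(ltW x0) // -powRrM mulN1r. Qed.

Lemma powR_le_sqr (p m a : R) : 2 <= p -> 0 <= a -> a <= m ->
  a `^ p <= m `^ (p - 2) * a ^+ 2.
Proof.
move=> p2 a0 am; rewrite -(powR_mulrn 2 a0).
have -> : a `^ p = a `^ (p - 2) * a `^ 2.
  rewrite -powRD ?subrK //; apply/implyP => /eqP p0.
  by move: p2; rewrite p0 leNgt ltr0n.
rewrite ler_wpM2r ?powR_ge0 //; apply: ge0_ler_powR; rewrite ?nnegrE ?subr_ge0 //.
exact: le_trans am.
Qed.

(** With [a = dH / dW], [b = 1 / (dW - 1)] and [D = mdist x y `^ dW] this is the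
sub-Gaussian profile at time [s]. *)
Definition stretched a b c D s : R := s `^ (- a) * expR (- (c * (D / s) `^ b)).

Lemma stretched_ge0 a b c D s : 0 <= stretched a b c D s.
Proof. by rewrite mulr_ge0 ?powR_ge0 ?expR_ge0. Qed.

(** Scaling reduces every estimate of a profile to the case [D = 1]. *)
Lemma stretched_scale a b c D s : 0 < D -> 0 < s ->
  stretched a b c D s = D `^ (- a) * stretched a b c 1 (s / D).
Proof.
move=> D0 s0; rewrite /stretched mulrA -powRM; [|exact: ltW|by rewrite divr_ge0 ?ltW].
by congr (_ `^ _ * expR (- (_ * _ `^ _))); field; rewrite !gt_eqF.
Qed.

Lemma measurable_stretched a b c D : 0 < D ->
  measurable_fun (`]0, +oo[%classic : set R) (stretched a b c D).
Proof.
move=> D0; pose g s := s `^ (- a) * expR (- (c * (D `^ b * s `^ (- b)))).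
apply: (eq_measurable_fun g) => [s|].
  move/set_mem; rewrite /= in_itv /= andbT => s0; rewrite /g /stretched.
  rewrite powRM; [|exact: ltW|by rewrite invr_ge0 ltW].
  by rewrite powR_inv.
apply: measurable_funTS; apply: measurable_funM; first exact: measurable_powR.
apply: measurableT_comp => //; apply: measurableT_comp => //.
do 2 apply: measurable_funM => //; exact: measurable_powR.
Qed.

Lemma onem_expR_ge u : 0 <= u -> u / (1 + u) <= 1 - expR (- u).
Proof.
move=> u0; have u1 : 0 < 1 + u by rewrite ltr_pwDl.
have : expR (- u) <= (1 + u)^-1.
  by rewrite expRN lef_pV2 ?posrE ?expR_gt0 ?expR_ge1Dx.
have -> : u / (1 + u) = 1 - (1 + u)^-1 by field; rewrite gt_eqF.
by move=> h; rewrite lerB.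
Qed.

Lemma expR_ge_powR (m x : R) : 0 < m -> 0 <= x -> (x / m) `^ m <= expR x.
Proof.
move=> m0 x0; have -> : expR x = (expR (x / m)) `^ m.
  by rewrite -expRM divfK ?gt_eqF.
have xm : 0 <= x / m by rewrite divr_ge0 // ltW.
apply: ge0_ler_powR; rewrite ?nnegrE ?expR_ge0 ?(ltW m0) //.
by apply: le_trans (expR_ge1Dx _); rewrite lerDr.
Qed.

(** Near 0 the profile vanishes faster than any power, so it is below a multiple of
[u]; for large [u] it is bounded.  The function [1 - expR (- u)] is of order
[min (u, 1)]. *)
Lemma stretched_le_onem_expR a b c : 0 <= a -> 0 < b -> 0 < c ->
  exists2 C : R, 0 < C & forall u, 0 < u -> stretched a b c 1 u <= C * (1 - expR (- u)).
Proof.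
move=> a0 b0 c0; pose m := (a + 1) / b; have m0 : 0 < m by rewrite divr_gt0 ?ltr_wpDl.
pose K := (c / m) `^ (- m).
have K0 : 0 < K by rewrite powR_gt0 // divr_gt0.
exists (2 + 2 * K) => [|u u0]; first by rewrite addr_gt0 // mulr_gt0.
have bnd : stretched a b c 1 u <= K * u.
  have h : expR (- (c * (1 / u) `^ b)) <= K * u `^ (a + 1).
    have x0 : 0 < c * (1 / u) `^ b by rewrite mulr_gt0 // powR_gt0 // divr_gt0.
    have := expR_ge_powR m0 (ltW x0); rewrite expRN => h.
    apply: (@le_trans _ _ (((c * (1 / u) `^ b) / m) `^ m)^-1).
      by rewrite lef_pV2 // posrE ?expR_gt0 // powR_gt0 // divr_gt0.
    have cm : 0 <= c / m by rewrite divr_ge0 // ltW.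
    rewrite -powRN mulrAC powRM ?powR_ge0 // -/K.
    rewrite -powRrM div1r powR_inv // ler_pM2l //.
    rewrite (_ : - (b * - m) = a + 1) // /m; field; rewrite gt_eqF //.
  rewrite /stretched; apply: le_trans (ler_wpM2l (powR_ge0 _ _) h) _.
  rewrite mulrCA ler_pM2l // -powRD; last by rewrite (gt_eqF u0) implybT.
  by rewrite addKr powRr1 // ltW.
apply: (@le_trans _ _ ((2 + 2 * K) * (u / (1 + u)))); last first.
  by rewrite ler_pM2l ?onem_expR_ge ?ltW // addr_gt0 // mulr_gt0.
have u1 : 0 < 1 + u by rewrite addr_gt0.
rewrite mulrA ler_pdivlMr //.
have [ul|ug] := lerP u 1.
  have : stretched a b c 1 u * (1 + u) <= K * u * 2.
    apply: ler_pM => //; [exact: stretched_ge0|exact: ltW|lra].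
  by nra.
have s1 : stretched a b c 1 u <= 1.
  rewrite -[leRHS]mulr1 ler_pM ?powR_ge0 ?expR_ge0 //.
    by rewrite -[leRHS](powRr0 u); apply: ler_powR; [exact: ltW|rewrite oppr_le0].
  by rewrite -[leRHS]expR0 ler_expR oppr_le0 mulr_ge0 ?powR_ge0 ?ltW.
have : stretched a b c 1 u * (1 + u) <= 1 * (1 + u) by rewrite ler_pM2r.
by nra.
Qed.

(** A lower bound of the profile by a function whose integral against the
subordinator is explicit.  The difference [expR (- u) - expR (- (2 * u))] has a
Laplace image of order [t], but for small [u] it is of order [u] and exceeds every
multiple of the profile.  There the second difference, at the scale [e], makes up
for it: with [v = u / (2 * e) <= 1 / 2], [expR (- v) - expR (- (2 * v)) >= v / 3],
and [6 * e * (v / 3) = u].  For [u >= e] the left-hand side is at most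
[expR (- u)] plus the second term on the right, hence controlled by [u `^ (- a)].
Since [delta < 1], the correction costs little after integration when [e] is
small; see [laplace_window]. *)
Lemma stretched_window a b c (e : R) : 0 <= a -> 0 < b -> 0 < c -> 0 < e ->
  exists2 C : R, 0 < C & forall u, 0 < u ->
    expR (- u) + 6 * e * expR (- (u / e)) <=
    expR (- (2 * u)) + 6 * e * expR (- (u / (2 * e))) + C * stretched a b c 1 u.
Proof.
move=> a0 b0 c0 e0.
have [M M0 hM] : exists2 M : R, 0 < M & forall u, 0 < u -> expR (- u) <= M * u `^ (- a).
  (* any exponent larger than [a] would do for large [u] *)
  pose m := a + 1; have m0 : 0 < m by rewrite ltr_wpDl.
  exists (m `^ m + 1) => [|u u0]; first by rewrite ltr_wpDl ?powR_ge0.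
  have [u1|u1] := leP u 1.
    rewrite -[leLHS]mul1r ler_pM ?expR_ge0 // ?lerDr ?powR_ge0 //.
    apply: (@le_trans _ _ 1); first by rewrite -expR0 ler_expR oppr_le0 ltW.
    by rewrite -(powRr0 u) ger_powR ?u0 // oppr_le0.
  have := expR_ge_powR m0 (ltW u0); rewrite powRM ?invr_ge0 ?(ltW m0) ?(ltW u0) // => h.
  apply: (@le_trans _ _ (m `^ m * u `^ (- m))).
    rewrite expRN -[leRHS]invrK lef_pV2 ?posrE ?expR_gt0 //; last first.
      by rewrite invr_gt0 mulr_gt0 ?powR_gt0.
    apply: le_trans h; rewrite invfM -!powRN opprK mulrC.
    by rewrite powR_inv.
  apply: ler_pM; rewrite ?powR_ge0 // ?lerDl //.
  by apply: ler_powR; [exact: ltW|rewrite lerN2 lerDl].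
pose k := expR (- (c * (1 / e) `^ b)); have k0 : 0 < k by exact: expR_gt0.
exists (M / k) => [|u u0]; first exact: divr_gt0.
pose v := u / (2 * e); have v0 : 0 < v by rewrite divr_gt0 // mulr_gt0.
have -> : u / e = v + v by rewrite /v; field; rewrite gt_eqF.
have -> : 2 * u = u + u by ring.
rewrite -/v !opprD !expRD; set x := expR (- u); set y := expR (- v).
have x0 : 0 < x by exact: expR_gt0. have y0 : 0 < y by exact: expR_gt0.
have x1 : x <= 1 by rewrite -expR0 ler_expR oppr_le0 ltW.
have y1 : y <= 1 by rewrite -expR0 ler_expR oppr_le0 ltW.
have [ue|ue] := leP u e.
  have hx : 1 - u <= x by exact: expR_ge1Dx.
  have v2 : v <= 1 / 2 by rewrite /v ler_pdivrMr ?mulr_gt0 //; lra.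
  have hy : 1 / 2 <= y by apply: le_trans (expR_ge1Dx _); lra.
  have hv := onem_expR_ge (ltW v0); rewrite -/y in hv.
  have hv2 : v * (2 / 3) <= v / (1 + v).
    by rewrite ler_pM2l // -[2/3]invf_div lef_pV2 ?posrE //; lra.
  have uv : u = v * (2 * e) by rewrite /v divfK // gt_eqF // mulr_gt0.
  have p1 : v * (1 / 3) <= y * (1 - y) by nra.
  have p2 : x * (1 - x) <= u by nra.
  have p3 : u <= 6 * e * (y * (1 - y)).
    have := ler_wpM2l (ltW e0) p1; lra.
  have : 0 <= M / k * stretched a b c 1 u by rewrite mulr_ge0 ?stretched_ge0 ?divr_ge0 ?ltW.
  lra.
have hs : x <= M / k * stretched a b c 1 u.
  rewrite (_ : _ * _ = M * u `^ (- a) * (k^-1 * expR (- (c * (1 / u) `^ b)))); last first.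
    by rewrite /stretched; ring.
  apply: le_trans (hM _ u0) _.
  rewrite -[leLHS]mulr1 ler_pM2l ?mulr_gt0 ?powR_gt0 //.
  rewrite [_^-1 * _]mulrC (ler_pdivlMr _ _ k0) [1 * k]mul1r /k ler_expR lerN2 ler_pM2l //.
  apply: ge0_ler_powR; rewrite ?nnegrE ?divr_ge0 ?ltW //.
  by rewrite !div1r ltf_pV2.
have p4 : 0 <= 6 * e * (y * (1 - y)) by rewrite !mulr_ge0 ?subr_ge0 // ltW.
have : 0 <= x * x by rewrite mulr_ge0 // ltW.
lra.
Qed.

End stretched_exponential.

(** * Integrals against the stable subordinator *)

Section subordinator.
Variables (R : realType) (delta : R) (eta : R -> R -> R).
Hypotheses (delta_gt0 : 0 < delta) (delta_lt1 : delta < 1).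
Hypothesis eta_density : stable_subordinator_density delta eta.
Let leb := (@lebesgue_measure R).
Let pos : set R := `]0, +oo[.

Let pos_gt0 s : pos s -> 0 < s.
Proof. by rewrite /pos /= in_itv /= andbT. Qed.

Let mpos : measurable pos. Proof. exact: measurable_itv. Qed.

Let eta_ge0 (t s : R) : 0 < t -> pos s -> 0 <= eta t s.
Proof. by move=> t0 /pos_gt0 s0; have [_ + _] := eta_density t0; exact. Qed.

Lemma measurable_eta (t : R) : 0 < t -> measurable_fun pos (eta t).
Proof.
move=> t0; have [ce _ _] := eta_density t0.
apply: open_continuous_measurable_fun; first exact: interval_open.
by move=> x /set_mem xpos; exact: ce.
Qed.

Lemma eta_laplace (t l : R) : 0 < t -> 0 < l ->
  (\int[leb]_(s in pos) (eta t s * expR (- (s * l)))%:E)%E =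
  (expR (- (t * l `^ delta)))%:E.
Proof. by move=> t0 l0; have [_ _] := eta_density t0; exact. Qed.

Let meta_exp (t l : R) : 0 < t ->
  measurable_fun pos (fun s => (eta t s * expR (- (s * l)))%:E).
Proof.
move=> t0; apply/measurable_EFinP; apply: measurable_funM; first exact: measurable_eta.
apply: measurable_funTS; apply: measurableT_comp => //.
by apply: measurableT_comp => //; apply: measurable_funM.
Qed.

(** The Laplace transform is known for positive parameters only; the mass is its
limit at 0, by monotone convergence. *)
Lemma eta_mass_le1 (t : R) : 0 < t -> (\int[leb]_(s in pos) (eta t s)%:E <= 1)%E.
Proof.
move=> t0; pose g (n : nat) s := (eta t s * expR (- (s * n.+1%:R^-1)))%:E.
have gE s : pos s -> limn (g ^~ s) = (eta t s)%:E.
  move=> sp; apply/cvg_lim => //; apply: cvg_EFin; first by apply: nearW.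
  rewrite [X in _ --> X](_ : _ = eta t s * expR (- (s * 0))); last first.
    by rewrite mulr0 oppr0 expR0 mulr1.
  apply: cvgM; first exact: cvg_cst.
  apply: continuous_cvg; first exact: continuous_expR.
  by apply: cvgN; apply: cvgM; [exact: cvg_cst|exact: cvg_harmonic].
rewrite (@eq_integral _ (measurableTypeR R) R leb pos (fun s => limn (g ^~ s)));
  last by move=> s /set_mem /gE.
have mono s : pos s -> {homo g ^~ s : n m / (n <= m)%N >-> (n <= m)%E}.
  move=> sp n m nm; rewrite lee_fin ler_wpM2l ?eta_ge0 // ler_expR lerN2.
  by rewrite ler_wpM2l ?(ltW (pos_gt0 sp)) // lef_pV2 ?posrE // ler_nat.
rewrite monotone_convergence //; first last.
- by move=> n s sp; rewrite lee_fin mulr_ge0 ?eta_ge0 ?expR_ge0.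
- by move=> n; exact: meta_exp.
apply: lime_le.
  apply: ereal_nondecreasing_is_cvgn => n m nm.
  apply: ge0_le_integral_lower => s sp; last exact: mono.
  by rewrite lee_fin mulr_ge0 ?eta_ge0 ?expR_ge0.
apply: nearW => n; rewrite eta_laplace // lee_fin -expR0 ler_expR oppr_le0.
by rewrite mulr_ge0 ?powR_ge0 ?ltW.
Qed.

(** As the mass is at most 1, the integral is at most
[1 - expR (- (t * l `^ delta)) <= t * l `^ delta]. *)
Lemma eta_onem_exp_le (t l : R) : 0 < t -> 0 < l ->
  (\int[leb]_(s in pos) (eta t s * (1 - expR (- (s * l))))%:E <= (t * l `^ delta)%:E)%E.
Proof.
move=> t0 l0; have := eta_mass_le1 t0.
rewrite (@eq_integral _ (measurableTypeR R) R leb pos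
  (fun s => (eta t s * (1 - expR (- (s * l))))%:E + (eta t s * expR (- (s * l)))%:E)%E); last first.
  by move=> s _; rewrite -EFinD -mulrDr subrK mulr1.
have pe s : pos s -> expR (- (s * l)) <= 1.
  by move=> /pos_gt0 s0; rewrite -expR0 ler_expR oppr_le0 mulr_ge0 ?ltW.
rewrite ge0_integralD //; first last.
- exact: meta_exp.
- by move=> s sp; rewrite lee_fin mulr_ge0 ?eta_ge0 ?expR_ge0.
- apply/measurable_EFinP; apply: measurable_funM; first exact: measurable_eta.
  apply: measurable_funB => //; apply: measurable_funTS; apply: measurableT_comp => //.
  by apply: measurableT_comp => //; apply: measurable_funM.
- by move=> s sp; rewrite lee_fin mulr_ge0 ?eta_ge0 ?subr_ge0 ?pe.
rewrite eta_laplace // => h.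
have := expR_ge1Dx (- (t * l `^ delta)); move=> h2.
move: h; set I := (\int[_]_(_ in _) _)%E; case: I => [r||] //=.
  by rewrite -EFinD !lee_fin; lra.
by move=> _; rewrite leNye.
Qed.

Lemma subordinated_stretched_le (a b c : R) : 0 <= a -> 0 < b -> 0 < c ->
  exists2 C : R, 0 < C & forall t D : R, 0 < t -> 0 < D ->
   (\int[leb]_(s in pos) (eta t s * stretched a b c D s)%:E <=
    (C * (t * D `^ (- (a + delta))))%:E)%E.
Proof.
move=> a0 b0 c0; have [C C0 hC] := stretched_le_onem_expR a0 b0 c0.
exists C => // t D t0 D0.
have DaC : 0 < D `^ (- a) * C by rewrite mulr_gt0 ?powR_gt0.
have le1 s : pos s -> ((eta t s * stretched a b c D s)%:E <=
    (D `^ (- a) * C)%:E * (eta t s * (1 - expR (- (s * D^-1))))%:E)%E.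
  move=> sp; have s0 := pos_gt0 sp; rewrite -EFinM lee_fin stretched_scale //.
  have := ler_wpM2l (eta_ge0 t0 sp) (ler_wpM2l (powR_ge0 D (- a)) (hC _ (divr_gt0 s0 D0))).
  by move=> h; apply: le_trans h _; rewrite le_eqVlt; apply/orP; left; apply/eqP; ring.
apply: (le_trans (@ge0_le_integral_lower _ (measurableTypeR R) R leb pos _ _ _ le1)).
  by move=> s sp; rewrite lee_fin mulr_ge0 ?stretched_ge0 ?eta_ge0.
rewrite ge0_integralZl_lower //; last first.
  move=> s sp; rewrite lee_fin mulr_ge0 ?eta_ge0 // subr_ge0 -expR0 ler_expR.
  by rewrite oppr_le0 divr_ge0 // ltW // pos_gt0.
apply: (@le_trans _ _ ((D `^ (- a) * C)%:E * (t * D^-1 `^ delta)%:E)%E).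
  by rewrite lee_pmul2l // eta_onem_exp_le // invr_gt0.
rewrite -EFinM lee_fin powR_inv // opprD powRD ?(gt_eqF D0) ?implybT //.
by rewrite le_eqVlt; apply/orP; left; apply/eqP; ring.
Qed.

Lemma expRB_le (x y : R) : 0 <= x -> x <= y -> expR (- x) - expR (- y) <= y - x.
Proof.
move=> x0 xy; have -> : expR (- y) = expR (- x) * expR (- (y - x)).
  by rewrite -expRD; congr expR; ring.
have h := expR_ge1Dx (- (y - x)).
have e0 := expR_gt0 (- x); have e1 : expR (- x) <= 1 by rewrite -expR0 ler_expR oppr_le0.
by nra.
Qed.

Lemma expRB_ge (x y : R) : x <= y -> expR (- y) * (y - x) <= expR (- x) - expR (- y).
Proof.
move=> xy; have -> : expR (- x) = expR (- y) * expR (y - x).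
  by rewrite -expRD; congr expR; ring.
have h := expR_ge1Dx (y - x).
have e0 := expR_gt0 (- y); nra.
Qed.

(** Integrating the inequality of [stretched_window] at time [t] and scale [D], with
[tau = t * D `^ (- delta)], replaces each [expR (- (u * l))] by
[expR (- (tau * l `^ delta))].  The first difference is then at least
[expR (- 2) * (2 `^ delta - 1) * tau]; the correction is at most
[6 * e * e `^ (- delta) * tau], half of it when [e] is small. *)
Lemma laplace_window (e tau z : R) : 0 < e ->
  e * e `^ (- delta) <= expR (- 2) * (2 `^ delta - 1) / 12 -> 0 < tau -> tau <= 1 ->
  expR (- tau) + 6 * e * expR (- (tau * e `^ (- delta))) <=
  expR (- (tau * 2 `^ delta)) + 6 * e * expR (- (tau * (2 * e) `^ (- delta))) + z ->
  expR (- 2) * (2 `^ delta - 1) / 2 * tau <= z.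
Proof.
move=> e0 eE tau0 tau1.
have q2 : 1 < 2 `^ delta.
  by have := @gt0_ltr_powR R _ delta_gt0 1 2; rewrite powR1; apply; rewrite ?nnegrE //; lra.
have q3 : 2 `^ delta <= 2 by apply: ler1_powR => //; [lra|exact: ltW].
set x := tau * (2 * e) `^ (- delta); set y := tau * e `^ (- delta).
have xy : x <= y.
  rewrite ler_pM2l // powRM ?(ltW e0) // -[leRHS]mul1r ler_pM2r ?powR_gt0 //.
  by rewrite powRN invf_le1 ?powR_gt0 // ltW.
have x0 : 0 <= x by rewrite mulr_ge0 ?powR_ge0 ?(ltW tau0).
have h1 := ler_wpM2l (ltW e0) (expRB_le x0 xy).
have {eE} : e * y <= expR (- 2) * (2 `^ delta - 1) / 12 * tau.
  by rewrite /y mulrCA mulrC ler_pM2r.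
have : 0 <= e * x by rewrite mulr_ge0 // ltW.
move: (2 `^ delta) q2 q3 => w q2 q3.
have t2 : tau <= tau * w by rewrite -[leLHS]mulr1 ler_pM2l // ltW.
have h2 := expRB_ge t2.
have h3 : expR (- 2) <= expR (- (tau * w)).
  rewrite ler_expR lerN2 -[leRHS]mul1r ler_pM ?(ltW tau0) //.
  by rewrite (le_trans _ (ltW q2)).
have h4 : expR (- 2) * (tau * w - tau) <= expR (- (tau * w)) * (tau * w - tau).
  by rewrite ler_wpM2r // subr_ge0.
clear -h1 h2 h4; move: h1 h2 h4.
move: (expR (- 2)) (expR (- (tau * w))) (expR (- tau)) (expR (- x)) (expR (- y)).
move=> E2 E3 E4 E5 E6; lra.
Qed.

Lemma subordinated_stretched_ge (a b c : R) : 0 <= a -> 0 < b -> 0 < c ->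
  exists2 k : R, 0 < k & forall t D : R, 0 < t -> 0 < D -> t <= D `^ delta ->
   ((k * (t * D `^ (- (a + delta))))%:E <=
    \int[leb]_(s in pos) (eta t s * stretched a b c D s)%:E)%E.
Proof.
move=> a0 b0 c0.
pose q : R := expR (- 2) * (2 `^ delta - 1).
have q2 : 1 < 2 `^ delta.
  by have := @gt0_ltr_powR R _ delta_gt0 1 2; rewrite powR1; apply; rewrite ?nnegrE //; lra.
have q0 : 0 < q by rewrite mulr_gt0 ?expR_gt0 ?subr_gt0.
(* solves [e * e `^ (- delta) = q / 12], the threshold of [laplace_window] *)
pose e := (q / 12) `^ (1 - delta)^-1.
have q12 : 0 < q / 12 by rewrite divr_gt0.
have e0 : 0 < e by rewrite powR_gt0.
have eE : e * e `^ (- delta) = q / 12.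
  rewrite -{1}(powRr1 (ltW e0)) -powRD; last by rewrite (gt_eqF e0) implybT.
  by rewrite /e -powRrM mulVf ?powRr1 ?(ltW q12) // subr_eq0 (gt_eqF delta_lt1).
have [C C0 hC] := stretched_window a0 b0 c0 e0.
exists (q / (2 * C)) => [|t D t0 D0 tD]; first by rewrite divr_gt0 // mulr_gt0.
pose tau := t * D `^ (- delta).
have DV (l : R) : 0 < l -> t * (l / D) `^ delta = tau * l `^ delta.
  move=> l0; rewrite powRM ?(ltW l0) ?invr_ge0 ?(ltW D0) // powR_inv // /tau.
  by rewrite mulrAC mulrA.
have tau0 : 0 < tau by rewrite mulr_gt0 ?powR_gt0.
have tau1 : tau <= 1 by rewrite /tau powRN ler_pdivrMr ?powR_gt0 // mul1r.
pose G (l1 l2 : R) s := eta t s * (expR (- (s * l1)) + 6 * e * expR (- (s * l2))).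
have mexp (l : R) : measurable_fun pos (fun s => expR (- (s * l))).
  apply: measurable_funTS; apply: measurableT_comp => //.
  by apply: measurableT_comp => //; apply: measurable_funM.
have mG l1 l2 : measurable_fun pos (fun s => (G l1 l2 s)%:E).
  apply/measurable_EFinP; apply: measurable_funM; first exact: measurable_eta.
  by apply: measurable_funD => //; apply: measurable_funM.
have G0 l1 l2 s : pos s -> (0 <= (G l1 l2 s)%:E)%E.
  move=> sp; rewrite lee_fin mulr_ge0 ?eta_ge0 // addr_ge0 ?expR_ge0 //.
  by rewrite !mulr_ge0 ?expR_ge0 // ltW.
have iG l1 l2 : 0 < l1 -> 0 < l2 -> (\int[leb]_(s in pos) (G (l1 / D) (l2 / D) s)%:E =
    (expR (- (tau * l1 `^ delta)) + 6 * e * expR (- (tau * l2 `^ delta)))%:E)%E.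
  move=> l10 l20; have d1 : 0 < l1 / D by rewrite divr_gt0.
  have d2 : 0 < l2 / D by rewrite divr_gt0.
  rewrite -!DV // EFinD EFinM -!eta_laplace //.
  have e6 : 0 <= 6 * e by rewrite mulr_ge0 // ltW.
  rewrite -ge0_integralZl_EFin //; first last.
  - exact: meta_exp.
  - by move=> s sp; rewrite lee_fin mulr_ge0 ?eta_ge0 ?expR_ge0.
  rewrite -ge0_integralD //; first last.
  - by apply: emeasurable_funM => //; exact: meta_exp.
  - by move=> s sp; rewrite mule_ge0 // lee_fin mulr_ge0 ?eta_ge0 ?expR_ge0.
  - exact: meta_exp.
  - by move=> s sp; rewrite lee_fin mulr_ge0 ?eta_ge0 ?expR_ge0.
  apply: eq_integral => s _; rewrite -EFinM -EFinD /G; congr EFin; ring.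
pose S s := eta t s * stretched a b c D s.
have S0 s : pos s -> (0 <= (S s)%:E)%E.
  by move=> sp; rewrite lee_fin mulr_ge0 ?eta_ge0 ?stretched_ge0.
have mS : measurable_fun pos (fun s => (S s)%:E).
  apply/measurable_EFinP; apply: measurable_funM; first exact: measurable_eta.
  exact: measurable_stretched.
pose C' := C * D `^ a; have C'0 : 0 < C' by rewrite mulr_gt0 ?powR_gt0.
have main : (\int[leb]_(s in pos) (G (1 / D) (e^-1 / D) s)%:E <=
    \int[leb]_(s in pos) ((G (2 / D) ((2 * e)^-1 / D) s)%:E + C'%:E * (S s)%:E))%E.
  apply: ge0_le_integral_lower; first exact: G0.
  move=> s sp; have s0 := pos_gt0 sp.
  rewrite -EFinM -EFinD lee_fin /G /S /C' (stretched_scale _ _ _ D0 s0).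
  have -> : C * D `^ a * (eta t s * (D `^ (- a) * stretched a b c 1 (s / D))) =
     eta t s * (C * stretched a b c 1 (s / D)).
    have DD : D `^ a * D `^ (- a) = 1 by rewrite powRN divff // gt_eqF // powR_gt0.
    transitivity (eta t s * (C * stretched a b c 1 (s / D)) * (D `^ a * D `^ (- a))).
      by ring.
    by rewrite DD mulr1.
  rewrite -mulrDr ler_wpM2l ?eta_ge0 //.
  have := hC _ (divr_gt0 s0 D0).
  have -> : s * (1 / D) = s / D by rewrite mul1r.
  have -> : s * (e^-1 / D) = s / D / e by rewrite mulrCA mulrC.
  have -> : s * (2 / D) = 2 * (s / D) by rewrite mulrCA.
  have -> : s * ((2 * e)^-1 / D) = s / D / (2 * e) by rewrite mulrCA mulrC.
  by [].
have sI0 : (0 <= \int[leb]_(s in pos) (S s)%:E)%E by apply: integral_ge0.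
move: main; rewrite ge0_integralD //; first last.
- by apply: emeasurable_funM.
- by move=> s sp; rewrite mule_ge0 ?S0 // lee_fin ltW.
- exact: mG.
- by move=> s sp; exact: G0.
rewrite ge0_integralZl_EFin //; last exact: ltW.
have e2 : 0 < 2 * e by rewrite mulr_gt0.
rewrite !iG ?invr_gt0 //.
rewrite -/S; move: sI0; set I := (\int[_]_(_ in _) (S _)%:E)%E.
move: I => [r||] //=; last by move=> *; rewrite leey.
rewrite -EFinM -EFinD !lee_fin powR1 mulr1 !powR_inv // => r0 main.
have := laplace_window (z := C' * r) e0 _ tau0 tau1 main; rewrite eE => /(_ (lexx _)) h7.
have -> : q / (2 * C) * (t * D `^ (- (a + delta))) = (q / 2 * tau) / C'.
  rewrite /tau /C' opprD powRD ?(gt_eqF D0) ?implybT // [D `^ (- a)]powRN.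
  by field; rewrite !gt_eqF ?powR_gt0.
by rewrite ler_pdivrMr // [r * _]mulrC; exact: h7.
Qed.

End subordinator.

(** * Heat kernel bounds at every point *)

Lemma negligible_sub d (T : measurableType d) (R : realType) (m : set T -> \bar R)
  (A B : set T) : m.-negligible B -> A `<=` B -> m.-negligible A.
Proof. by case=> N [mN N0 BN] AB; exists N; split => //; exact: subset_trans BN. Qed.

Section product_full_support.
Context (d : measure_display) (R : realType) (X : borelMetricType d R).
Variable mu : {measure set X -> \bar R}.
Hypothesis rel_compact : forall (x : X) (r : R), compact (closure (ball x r)).
Hypothesis mu_support : full_support mu.

(** An open set contains a product of two balls, and both have positive measure; the
measure of the product is only bounded below here, as an iterated integral. *)
Lemma nonnegligible_open_product (O : set (X * X)) (z : X * X) :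
  nbhs z O -> ~ (mu \x mu)%E.-negligible O.
Proof.
case: z => x y /=; case=> -[A B] [/= /nbhs_ballP[a /= a0 aA] /nbhs_ballP[b /= b0 bB]] AB.
case=> N [mN N0 ON]; move: N0; rewrite /product_measure1 => N0.
have mU : (0 < mu (ball x a))%E.
  by apply: mu_support; [exact: open_ball_metric|exists x; exact: ballxx].
have mV : (0 < mu (ball y b))%E.
  by apply: mu_support; [exact: open_ball_metric|exists y; exact: ballxx].
suff : (0 < \int[mu]_x (mu \o xsection N) x)%E by rewrite N0 ltxx.
apply: (@lt_le_trans _ _ (\int[mu]_(u in ball x a) mu (ball y b))%E).
  by rewrite integral_cst ?mule_gt0 //; exact: ball_borel.
rewrite integral_mkcond; apply: ge0_le_integral_lower => u _; first exact: erestrict_ge0.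
rewrite /patch; case: ifP => [/set_mem xu|_]; last exact: measure_ge0.
apply: le_measure; [exact/mem_set/ball_borel|exact/mem_set/measurable_xsection|].
by move=> v yv; apply/xsectionP; apply/ON/AB; split => /=; [exact: aA|exact: bB].
Qed.

Lemma ae_le_continuity_point (f g : X * X -> R) (z0 : X * X) :
  {for z0, continuous f} -> {for z0, continuous g} ->
  (\forall z \ae (mu \x mu)%E, f z <= g z) -> f z0 <= g z0.
Proof.
move=> cf cg fg; rewrite leNgt; apply/negP => gf.
have : {for z0, continuous (f \- g)} by apply: continuousB.
move/cvgrPdist_lt => /(_ (f z0 - g z0)); rewrite subr_gt0 => /(_ gf) near0.
apply: (nonnegligible_open_product near0).
apply: negligible_sub fg _ => z /= h /= fgz; move: h.
by rewrite ltNge => /negP; apply; apply: le_trans (ler_norm _); lra.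
Qed.

End product_full_support.

Section kernel_bounds.
Context (d : measure_display) (R : realType) (X : borelMetricType d R).
Variable mu : {measure set X -> \bar R}.
Hypothesis rel_compact : forall (x : X) (r : R), compact (closure (ball x r)).
Hypothesis mu_support : full_support mu.
Variables (pt : R -> X -> X -> R) (dH dW : R).
Hypothesis pt_continuous : forall t, 0 < t -> continuous (fun z : X * X => pt t z.1 z.2).
Hypothesis pt_bounds : sub_gaussian_bounds mu pt dH dW.

Lemma powR_continuous_pos (a x : R) : 0 < x -> {for x, continuous (fun y : R => y `^ a : R)}.
Proof.
move=> x0; apply: differentiable_continuous; apply/derivable1_diffP.
by apply: derivable_powR; rewrite in_itv /= x0.
Qed.

Lemma stretched_mdist_continuous (a b c t : R) (z0 : X * X) : 0 < t ->
  0 < mdist z0.1 z0.2 ->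
  {for z0, continuous (fun z : X * X => stretched a b c (mdist z.1 z.2 `^ dW) t)}.
Proof.
move=> t0 z00; apply: continuousM; first exact: cst_continuous.
apply: continuous_comp; last exact: continuous_expR.
apply: continuousN; apply: continuousM; first exact: cst_continuous.
apply: (@continuous_comp _ _ _ (fun z : X * X => mdist z.1 z.2 `^ dW / t)
   (fun y : R => y `^ b)); last first.
  by apply: powR_continuous_pos; rewrite divr_gt0 ?powR_gt0.
apply: continuousM; last exact: cst_continuous.
apply: (@continuous_comp _ _ _ (fun z : X * X => mdist z.1 z.2) (fun y : R => y `^ dW)).
  exact: mdist_continuous.
exact: powR_continuous_pos.
Qed.

(** The two-sided bounds are assumed almost everywhere.  Off the diagonal all the
terms are continuous and nonempty open sets are not negligible, so the bounds hold
at every point. *)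
Lemma sub_gaussian_everywhere : exists c3 c4 c5 c6 : R,
  [/\ 0 < c3, 0 < c4, 0 < c5, 0 < c6 & forall t x y, 0 < t -> x != y ->
    c5 * stretched (dH / dW) (dW - 1)^-1 c6 (mdist x y `^ dW) t <= pt t x y /\
    pt t x y <= c3 * stretched (dH / dW) (dW - 1)^-1 c4 (mdist x y `^ dW) t].
Proof.
have [_ [c3 [c4 [c5 [c6 [c30 c40 c50 c60 ub]]]]]] := pt_bounds.
exists c3, c4, c5, c6; split => // t x y t0; rewrite -mdist_gt0 => xy.
have cS a b c k : {for (x, y), continuous (fun z : X * X =>
    k * stretched a b c (mdist z.1 z.2 `^ dW) t)}.
  by apply: continuousM; [exact: cst_continuous|exact: stretched_mdist_continuous].
have cp : {for (x, y), continuous (fun z : X * X => pt t z.1 z.2)} by exact: pt_continuous.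
split.
  apply: (ae_le_continuity_point mu_support (cS _ _ c6 c5) cp).
  apply: negligible_sub (ub _ t0) _ => z /= h h'; apply: h; move: h' => /andP[].
  by rewrite /stretched mulrA.
apply: (ae_le_continuity_point mu_support cp (cS _ _ c4 c3)).
apply: negligible_sub (ub _ t0) _ => z /= h h'; apply: h; move: h' => /andP[].
by rewrite /stretched mulrA.
Qed.

Lemma heat_kernel_ge0 t x y : 0 < t -> 0 <= pt t x y.
Proof.
move=> t0; have [_ [c3 [c4 [c5 [c6 [c30 c40 c50 c60 ub]]]]]] := pt_bounds.
have cp : {for (x, y), continuous (fun z : X * X => pt t z.1 z.2)} by exact: pt_continuous.
apply: (@ae_le_continuity_point _ _ _ mu mu_support (cst 0) _ (x, y) (@cst_continuous _ _ _ _) cp).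
apply: negligible_sub (ub _ t0) _ => z /= h /andP[h' _]; apply: h; apply: le_trans h'.
by rewrite !mulr_ge0 ?powR_ge0 ?expR_ge0 ?ltW.
Qed.

End kernel_bounds.

(** * Besov classes and fractional Sobolev spaces *)

Section subordinated_kernel_bounds.
Context (d : measure_display) (R : realType) (X : borelMetricType d R).
Variable mu : {measure set X -> \bar R}.
Hypothesis rel_compact : forall (x : X) (r : R), compact (closure (ball x r)).
Hypothesis mu_support : full_support mu.
Hypothesis sfmu : sigma_finite setT mu.
Variables (pt : R -> X -> X -> R) (dH dW : R).
Hypothesis dH_gt0 : 0 < dH.
Hypothesis pt_continuous :
  forall t : R, 0 < t -> continuous (fun z : X * X => pt t z.1 z.2).
Hypothesis pt_bounds : sub_gaussian_bounds mu pt dH dW.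
Variables (delta : R) (eta : R -> R -> R).
Hypotheses (delta_gt0 : 0 < delta) (delta_lt1 : delta < 1).
Hypothesis eta_density : stable_subordinator_density delta eta.

Let dW_gt1 : 1 < dW.
Proof. by have [dW2 _] := pt_bounds; apply: lt_le_trans dW2; rewrite ltr1n. Qed.

Let dW_gt0 : 0 < dW. Proof. exact: lt_trans dW_gt1. Qed.

Let a_ge0 : 0 <= dH / dW. Proof. by rewrite divr_ge0 // ltW. Qed.

Let b_gt0 : 0 < (dW - 1)^-1. Proof. by rewrite invr_gt0 subr_gt0. Qed.

Let dpow (r : R) : (r `^ dW) `^ (- (dH / dW + delta)) = (r `^ (dH + delta * dW))^-1.
Proof.
by rewrite -powRrM -powRN; congr (_ `^ _); field; rewrite gt_eqF.
Qed.

Let ptE_ge0 (t s : R) (x y : X) : 0 < t -> (`]0, +oo[%classic : set R) s ->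
  (0 <= (eta t s * pt s x y)%:E)%E.
Proof.
rewrite /= in_itv /= andbT => t0 s0; rewrite lee_fin mulr_ge0 //.
  by have [_ + _] := eta_density t0; exact.
exact: (heat_kernel_ge0 mu_support pt_continuous pt_bounds).
Qed.

Lemma subordinated_kernel_ge0 (t : R) (x y : X) : 0 < t ->
  (0 <= subordinated_kernel pt eta t x y)%E.
Proof. by move=> t0; apply: integral_ge0 => s; exact: ptE_ge0. Qed.

Lemma subordinated_kernel_le : exists2 C : R, 0 < C & forall (t : R) (x y : X),
  0 < t -> x != y ->
  (subordinated_kernel pt eta t x y <=
    (C * t / mdist x y `^ (dH + delta * dW))%:E)%E.
Proof.
have [c3 [c4 [c5 [c6 [c30 c40 c50 c60 hk]]]]] :=
  sub_gaussian_everywhere mu_support pt_continuous pt_bounds.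
have [C C0 hC] := subordinated_stretched_le eta_density a_ge0 b_gt0 c40.
exists (c3 * C) => [|t x y t0 xy]; first by rewrite mulr_gt0.
have D0 : 0 < mdist x y `^ dW by rewrite powR_gt0 // mdist_gt0.
have eta0 s : (`]0, +oo[%classic : set R) s -> 0 <= eta t s.
  by rewrite /= in_itv /= andbT => s0; have [_ + _] := eta_density t0; exact.
apply: (@le_trans _ _ (\int[@lebesgue_measure R]_(s in `]0%R, +oo[)
   (c3%:E * (eta t s * stretched (dH / dW) (dW - 1)^-1 c4 (mdist x y `^ dW) s)%:E))%E).
  apply: ge0_le_integral_lower => s sp; first exact: ptE_ge0.
  rewrite -EFinM lee_fin mulrCA ler_wpM2l ?eta0 //.
  by have [] := hk s x y _ xy; move: sp; rewrite /= in_itv /= andbT.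
rewrite ge0_integralZl_lower //; last first.
  by move=> s sp; rewrite lee_fin mulr_ge0 ?stretched_ge0 ?eta0.
rewrite -!mulrA EFinM lee_pmul2l // mulrA -mulrA -dpow; exact: hC.
Qed.

Lemma subordinated_kernel_ge : exists2 k : R, 0 < k & forall (t : R) (x y : X),
  0 < t -> x != y -> t <= mdist x y `^ (delta * dW) ->
  ((k * t / mdist x y `^ (dH + delta * dW))%:E <= subordinated_kernel pt eta t x y)%E.
Proof.
have [c3 [c4 [c5 [c6 [c30 c40 c50 c60 hk]]]]] :=
  sub_gaussian_everywhere mu_support pt_continuous pt_bounds.
have [k k0 hC] := subordinated_stretched_ge delta_gt0 delta_lt1 eta_density a_ge0 b_gt0 c60.
exists (c5 * k) => [|t x y t0 xy td]; first by rewrite mulr_gt0.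
have D0 : 0 < mdist x y `^ dW by rewrite powR_gt0 // mdist_gt0.
have eta0 s : (`]0, +oo[%classic : set R) s -> 0 <= eta t s.
  by rewrite /= in_itv /= andbT => s0; have [_ + _] := eta_density t0; exact.
have st0 s : (`]0, +oo[%classic : set R) s ->
   (0 <= (eta t s * stretched (dH / dW) (dW - 1)^-1 c6 (mdist x y `^ dW) s)%:E)%E.
  by move=> sp; rewrite lee_fin mulr_ge0 ?stretched_ge0 ?eta0.
apply: (@le_trans _ _ (\int[@lebesgue_measure R]_(s in `]0%R, +oo[)
   (c5%:E * (eta t s * stretched (dH / dW) (dW - 1)^-1 c6 (mdist x y `^ dW) s)%:E))%E).
  rewrite ge0_integralZl_lower // -!mulrA EFinM lee_pmul2l // mulrA -mulrA -dpow.
  by apply: hC => //; rewrite -powRrM mulrC.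
apply: ge0_le_integral_lower => s sp; first by rewrite mule_ge0 ?st0 // lee_fin ltW.
rewrite -EFinM lee_fin mulrCA ler_wpM2l ?eta0 //.
by have [] := hk s x y _ xy; move: sp; rewrite /= in_itv /= andbT.
Qed.

Section equivalence.
Variables (p : R) (p_ge2 : 2 <= p).

Let p_gt0 : 0 < p. Proof. exact: lt_le_trans p_ge2. Qed.

Let p_neq0 : p != 0. Proof. by rewrite gt_eqF. Qed.

Let G (f : X -> R) (x y : X) : \bar R :=
  (`|f x - f y| `^ p / mdist x y `^ (dH + delta * dW))%:E.

Let B (f : X -> R) (t : R) : \bar R := (\int[mu]_y \int[mu]_x
   ((`|f x - f y| `^ p)%:E * subordinated_kernel pt eta t x y))%E.

Let G_ge0 f x y : (0 <= G f x y)%E.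
Proof. by rewrite lee_fin divr_ge0 ?powR_ge0. Qed.

Let B_ge0 f t : 0 < t -> (0 <= B f t)%E.
Proof.
move=> t0; apply: integral_ge0 => y _; apply: integral_ge0 => x _.
by rewrite mule_ge0 ?lee_fin ?powR_ge0 // subordinated_kernel_ge0.
Qed.

(** For the smoothness [delta * dW / p] the exponent [dH + lambda * p] no longer
involves [p]. *)
Lemma sobolev_seminorm_lty f :
  (sobolev_seminorm mu dH (delta * dW / p) p f < +oo)%E <->
  (\int[mu]_x \int[mu]_y (`|f x - f y| `^ p / mdist x y `^ (dH + delta * dW))%:E
    < +oo)%E.
Proof.
rewrite /sobolev_seminorm divfK //; split; last exact: poweR_lty.
by apply: lty_poweRy; rewrite invr_eq0.
Qed.

Let besov_form_le : exists2 C : R, 0 < C & forall f t, 0 < t ->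
  (B f t <= (C * t)%:E * \int[mu]_x \int[mu]_y G f x y)%E.
Proof.
have [C C0 hC] := subordinated_kernel_le; exists C => // f t t0.
have Ct : 0 < C * t by rewrite mulr_gt0.
rewrite -ge0_integralZl_lower //; last by move=> x _; exact: integral_ge0.
apply: ge0_le_integral_lower => y _.
  apply: integral_ge0 => x _.
  by rewrite mule_ge0 ?lee_fin ?powR_ge0 // subordinated_kernel_ge0.
rewrite -ge0_integralZl_lower //; apply: ge0_le_integral_lower => x _.
  by rewrite mule_ge0 ?lee_fin ?powR_ge0 // subordinated_kernel_ge0.
have [->|xy] := eqVneq x y.
  by rewrite subrr normr0 powR0 // mul0e mule_ge0 // lee_fin ltW.
rewrite /G distrC metric_sym -EFinM mulrCA EFinM lee_wpmul2l //; exact: hC.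
Qed.

Let mG f : measurable_fun setT f -> measurable_fun setT (fun z : X * X => G f z.1 z.2).
Proof.
move=> mf; apply/measurable_EFinP; apply: measurable_funM.
  apply: (measurableT_comp (measurable_powR _)); apply: measurableT_comp => //.
  apply: measurable_funB; first exact: (measurableT_comp mf measurable_fst).
  exact: (measurableT_comp mf measurable_snd).
have -> : (fun z : X * X => (mdist z.1 z.2 `^ (dH + delta * dW))^-1) =
    (fun z : X * X => mdist z.1 z.2 `^ (- (dH + delta * dW))).
  by apply/funext => z; rewrite powRN.
apply: (measurableT_comp (measurable_powR _)).
exact: (continuous_product_borel rel_compact (@mdist_continuous _ _ X)).
Qed.

(** The lower kernel bound is available on the pairs with
[t <= mdist x y `^ (delta * dW)]; these increase to the complement of the diagonal
as [t] decreases to 0. *)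
Let sobolev_form_le : exists2 k : R, 0 < k & forall f (M : R), measurable_fun setT f ->
  (forall t, 0 < t -> (B f t <= (M * t)%:E)%E) ->
  (\int[mu]_x \int[mu]_y G f x y <= (k * M)%:E)%E.
Proof.
have [k k0 hk] := subordinated_kernel_ge; exists k^-1 => [|f M mf hM].
  by rewrite invr_gt0.
(* the pairs on which the lower bound holds at time [t = 1 / n.+1] *)
pose far n (z : X * X) := n.+1%:R^-1 <= mdist z.1 z.2 `^ (delta * dW).
pose Fn n (z : X * X) := if far n z then G f z.1 z.2 else 0%E.
apply: (@double_integral_le_limit _ _ _ mu sfmu Fn (fun z => G f z.1 z.2)).
- move=> n; apply: measurable_fun_ifT => //; last exact: mG.
  apply: measurable_fun_ler => //; apply: (measurableT_comp (measurable_powR _)).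
  exact: (continuous_product_borel rel_compact (@mdist_continuous _ _ X)).
- by move=> n z; rewrite /Fn; case: ifP.
- move=> z n m nm; rewrite /Fn; case: ifP => [fn|_]; last by case: ifP.
  rewrite (_ : far m z = true) //; apply: le_trans fn.
  by rewrite lef_pV2 ?posrE // ler_nat.
- move=> [x y]; have [xy|xy] := eqVneq x y.
    have -> : (fun n => Fn n (x, y)) = cst 0%E.
      apply/funext => n; rewrite /Fn; case: ifP => // _.
      by rewrite /G /= xy subrr normr0 powR0 // mul0r.
    by rewrite /G /= xy subrr normr0 powR0 // mul0r; exact: cvg_cst.
  apply: (@cvg_trans _ (cst (G f x y) n @[n --> \oo])); last exact: cvg_cst.
  apply: near_eq_cvg; have d0 : 0 < mdist x y `^ (delta * dW).
    by rewrite powR_gt0 // mdist_gt0.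
  near=> n; rewrite /Fn /far /= ltW //; near: n.
  exact: near_infty_natSinv_lt (PosNum d0).
move=> n; pose t : R := n.+1%:R^-1; have t0 : 0 < t by rewrite invr_gt0.
have c0 : 0 < (k * t)^-1 by rewrite invr_gt0 mulr_gt0.
apply: (@le_trans _ _ (((k * t)^-1)%:E * B f t)%E); last first.
  apply: (@le_trans _ _ (((k * t)^-1)%:E * (M * t)%:E)%E).
    by rewrite lee_pmul2l // hM.
  rewrite -EFinM lee_fin le_eqVlt; apply/orP; left; apply/eqP.
  by field; rewrite !gt_eqF.
rewrite -ge0_integralZl_lower //; last first.
  move=> y _; apply: integral_ge0 => x _.
  by rewrite mule_ge0 ?lee_fin ?powR_ge0 // subordinated_kernel_ge0.
apply: ge0_le_integral_lower => y _.
  by apply: integral_ge0 => x _; rewrite /Fn; case: ifP.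
rewrite -ge0_integralZl_lower //; last first.
  by move=> x _; rewrite mule_ge0 ?lee_fin ?powR_ge0 // subordinated_kernel_ge0.
apply: ge0_le_integral_lower => x _; first by rewrite /Fn; case: ifP.
have rhs0 : (0 <= ((k * t)^-1)%:E *
    ((`|f x - f y| `^ p)%:E * subordinated_kernel pt eta t x y))%E.
  by rewrite !mule_ge0 ?lee_fin ?powR_ge0 ?(ltW c0) // subordinated_kernel_ge0.
rewrite /Fn; case: ifP => // fn; have [xy|xy] := eqVneq x y.
  by rewrite (_ : G f _ _ = 0%E) // /G /= xy subrr normr0 powR0 // mul0r.
rewrite /far /= metric_sym in fn.
have := hk t x y t0 xy fn.
move=> /(lee_wpmul2l (_ : 0 <= ((k * t)^-1 * `|f x - f y| `^ p)%:E)%E).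
rewrite lee_fin mulr_ge0 ?powR_ge0 ?(ltW c0) // => /(_ isT).
rewrite EFinM -!muleA; apply: le_trans.
rewrite -!EFinM lee_fin /G /= distrC metric_sym le_eqVlt; apply/orP; left; apply/eqP.
by field; rewrite !gt_eqF // powR_gt0 // mdist_gt0.
Unshelve. all: by end_near. Qed.

(** The exponent [p^-1] of [t] in the Besov norm matches the linear growth in [t] of
the kernel: the norm is finite exactly when the energy at time [t] is at most a
multiple of [t]. *)
Lemma besov_eq_sobolev :
  besov mu pt eta p p^-1 = sobolev mu dH (delta * dW / p) p.
Proof.
apply/seteqP; split => f [fp]; rewrite /=; last first.
  move=> /sobolev_seminorm_lty; have [C C0 hC] := besov_form_le.
  rewrite -/(G f) => Nf; split => //.
  pose N := (\int[mu]_x \int[mu]_y G f x y)%E.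
  have N0 : (0 <= N)%E by apply: integral_ge0 => x _; exact: integral_ge0.
  apply: (@le_lt_trans _ _ ((C%:E * N) `^ p^-1)%E); last first.
    apply: poweR_lty; apply: lte_mul_pinfty => //; first by rewrite lee_fin ltW.
  apply: ge_ereal_sup => _ [t /= t0 <-].
  have tp : (0 <= (t `^ (- p^-1))%:E)%E by rewrite lee_fin powR_ge0.
  apply: (@le_trans _ _ ((t `^ (- p^-1))%:E * ((C * t)%:E * N) `^ p^-1)%E).
    apply: lee_wpmul2l => //; apply: gt0_ler_poweR; last exact: hC.
    - by rewrite invr_ge0 ltW.
    - by rewrite in_itv /= leey andbT; exact: B_ge0.
    - by rewrite in_itv /= leey andbT mule_ge0 // lee_fin mulr_ge0 // ltW.
  have CN0 : (0 <= C%:E * N)%E by rewrite mule_ge0 // lee_fin ltW.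
  rewrite (mulrC C) EFinM -muleA (@poweRM _ t%:E) ?lee_fin ?(ltW t0) //.
  rewrite muleA poweR_EFin -EFinM -powRD; last by rewrite (gt_eqF t0) implybT.
  by rewrite addNr powRr0 mul1e.
move=> bf; split => //; apply/sobolev_seminorm_lty.
have [k k0 hk] := sobolev_form_le.
have tm t : 0 < t -> ((t `^ (- p^-1))%:E * (B f t) `^ p^-1 <= besov_norm mu pt eta p p^-1 f)%E.
  by move=> t0; apply: ereal_sup_ubound; exists t.
have b0 : (0 <= besov_norm mu pt eta p p^-1 f)%E.
  by apply: le_trans (tm 1 ltr01); rewrite mule_ge0 ?poweR_ge0 // lee_fin powR_ge0.
move: bf b0 tm; case: (besov_norm _ _ _ _ _ _) => [M||] //= _; rewrite lee_fin => M0 tm.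
have mf := Lfun_measurable fp.
apply: le_lt_trans (hk f (M `^ p) mf _) (ltry _) => t t0.
have h : ((B f t) `^ p^-1 <= (M * t `^ p^-1)%:E)%E.
  have tp0 : 0 < t `^ (- p^-1) by rewrite powR_gt0.
  rewrite -(@lee_pmul2l _ (t `^ (- p^-1))%:E) //; apply: le_trans (tm t t0) _.
  by rewrite -EFinM lee_fin mulrCA -powRD ?addNr ?powRr0 ?mulr1 // (gt_eqF t0) implybT.
have -> : B f t = ((B f t `^ p^-1) `^ p)%E.
  by rewrite -poweRrM mulVf // poweRe1 // B_ge0.
have -> : M `^ p * t = (M * t `^ p^-1) `^ p.
  by rewrite powRM ?powR_ge0 // -powRrM mulVf // powRr1 // ltW.
rewrite -poweR_EFin; apply: gt0_ler_poweR h; first exact: ltW.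
- by rewrite in_itv /= leey poweR_ge0.
- by rewrite in_itv /= leey andbT lee_fin mulr_ge0 ?powR_ge0.
Qed.

End equivalence.
End subordinated_kernel_bounds.

(** * Riesz representation for semidefinite forms *)

Section riesz.
Variable R : realType.

Lemma discriminant_le (a b c : R) : 0 <= a ->
  (forall s : R, 0 <= c + 2 * s * b + s ^+ 2 * a) -> b ^+ 2 <= a * c.
Proof.
rewrite le_eqVlt => /predU1P[<-|a0] h.
  have [->|b0] := eqVneq b 0; first by rewrite expr0n mul0r.
  have := h (- (c + 1) / (2 * b)).
  have -> : c + 2 * (- (c + 1) / (2 * b)) * b + (- (c + 1) / (2 * b)) ^+ 2 * 0 = - 1.
    by field; rewrite b0.
  by rewrite oppr_ge0 ler10.
have := h (- b / a).
have -> : c + 2 * (- b / a) * b + (- b / a) ^+ 2 * a = (a * c - b ^+ 2) / a.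
  by field; rewrite gt_eqF.
by rewrite pmulr_lge0 ?invr_gt0 // subr_ge0.
Qed.

Variables (V : lmodType R) (F : set V) (a : V -> V -> R).
Hypothesis F0 : F 0.
Hypothesis F_lin : forall (s : R) u v, F u -> F v -> F (s *: u + v).
Hypothesis a_lin : forall (s : R) u v w, F u -> F v -> F w ->
  a (s *: u + v) w = s * a u w + a v w.
Hypothesis a_sym : forall u v, F u -> F v -> a u v = a v u.
Hypothesis a_ge0 : forall u, F u -> 0 <= a u u.

Lemma subspace_sub u v : F u -> F v -> F (u - v).
Proof. by move=> Fu Fv; rewrite addrC -scaleN1r; exact: F_lin. Qed.

Lemma bilinear_subl u v w : F u -> F v -> F w -> a (u - v) w = a u w - a v w.
Proof. by move=> Fu Fv Fw; rewrite addrC -scaleN1r a_lin // mulN1r addrC. Qed.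

Lemma bilinear_sqr (s : R) u v : F u -> F v ->
  a (s *: u + v) (s *: u + v) = a v v + 2 * s * a u v + s ^+ 2 * a u u.
Proof.
move=> Fu Fv; have Fw := F_lin s Fu Fv.
rewrite a_lin // (a_sym Fu Fw) (a_sym Fv Fw) !a_lin // (a_sym Fv Fu); ring.
Qed.

Lemma bilinear_cauchy_schwarz u v : F u -> F v -> (a u v) ^+ 2 <= a u u * a v v.
Proof.
move=> Fu Fv; apply: discriminant_le => [|s]; first exact: a_ge0.
by rewrite -bilinear_sqr //; apply: a_ge0; exact: F_lin.
Qed.

(** The elements of [V] are genuine functions and [a] is only semidefinite, so
completeness is available only as the existence of limits of Cauchy sequences.
The vector is the limit of a minimizing sequence of [J u = a u u - 2 l u].  Near the
infimum the derivative of [J] in a direction [g] is small ([B_sqr]); this yields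
both the Cauchy property, by taking [g] to be a difference of two terms, and the
Euler equation at the limit. *)
Lemma riesz_representation (l : V -> R) (K : R) :
  (forall (s : R) u v, F u -> F v -> l (s *: u + v) = s * l u + l v) ->
  (forall u, F u -> - K <= a u u - 2 * l u) ->
  (forall u_ : nat -> V, (forall n, F (u_ n)) ->
    (forall e : R, 0 < e -> exists N : nat, forall m n : nat,
      (N <= m)%N -> (N <= n)%N -> a (u_ m - u_ n) (u_ m - u_ n) < e) ->
    exists2 u, F u & forall e : R, 0 < e -> exists N : nat, forall n : nat,
      (N <= n)%N -> a (u_ n - u) (u_ n - u) < e) ->
  exists2 u, F u & forall g, F g -> a u g = l g.
Proof.
move=> l_lin bnd complete.
pose J u := a u u - 2 * l u; pose S := [set J u | u in F].
have hS : has_inf S.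
  by split; [exists (J 0); exists 0|exists (- K) => _ [u Fu <-]; exact: bnd].
(* tolerance of the [n]-th term of the minimizing sequence *)
pose eps n : R := n.+1%:R^-1.
have /choice[u_ hu] : forall n, exists u, F u /\ J u < inf S + eps n.
  move=> n; have [_ [u Fu <-] hu] := @inf_adherent _ S (eps n) (ltac:(by rewrite /eps)) hS.
  by exists u.
have Fu n : F (u_ n) by have [] := hu n.
have B_sqr n g : F g -> (a (u_ n) g - l g) ^+ 2 <= a g g * eps n.
  move=> Fg; apply: discriminant_le => [|s]; first exact: a_ge0.
  have Fsg := F_lin s Fg (Fu n).
  have h1 : inf S <= J (s *: g + u_ n) by apply: ge_inf; [case: hS|exists (s *: g + u_ n)].
  have [_ h2] := hu n; move: h1 h2; rewrite /J bilinear_sqr // l_lin // (a_sym Fg) //.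
  by move=> h1 h2; lra.
have sqr2 (x y : R) : (x + y) ^+ 2 <= 2 * (x ^+ 2 + y ^+ 2).
  by have := sqr_ge0 (x - y); rewrite !expr2; lra.
have eps_small (e : R) : 0 < e -> exists N : nat, forall n : nat, (N <= n)%N -> eps n < e.
  move=> e0; have [N _ hN] := near_infty_natSinv_lt (PosNum e0).
  by exists N => n; exact: hN.
have cauchy (e : R) : 0 < e -> exists N : nat, forall m n : nat,
    (N <= m)%N -> (N <= n)%N -> a (u_ m - u_ n) (u_ m - u_ n) < e.
  move=> e0; have [N hN] := eps_small (e / 4) (ltac:(by rewrite divr_gt0)).
  exists N => m n mN nN; set g := u_ m - u_ n.
  have Fg : F g by exact: subspace_sub.
  have ag0 := a_ge0 Fg; have hm := B_sqr m g Fg; have hn := B_sqr n g Fg.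
  have : a g g = (a (u_ m) g - l g) + (- (a (u_ n) g - l g)).
    by rewrite {1}/g bilinear_subl //; ring.
  move=> agE; have := sqr2 (a (u_ m) g - l g) (- (a (u_ n) g - l g)).
  rewrite -agE sqrrN => h.
  have [->|agn0] := eqVneq (a g g) 0; first by [].
  have agp : 0 < a g g by rewrite lt0r agn0.
  have {h} : a g g * a g g <= a g g * (2 * (eps m + eps n)).
    by rewrite -expr2; move: h hm hn; clear; lra.
  rewrite ler_pM2l // => h; apply: le_lt_trans h _.
  by have := hN m mN; have := hN n nN; lra.
have [u Fu0 hconv] := complete u_ Fu cauchy.
exists u => // g Fg; apply/eqP; rewrite -subr_eq0 -sqrf_eq0 eq_le sqr_ge0 andbT.
apply/ler_addgt0Pl => e e0; rewrite addr0.
pose K' := 2 * (a g g + 1); have K'0 : 0 < K' by rewrite mulr_gt0 // ltr_wpDl // a_ge0.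
pose e' := e / (2 * K'); have e'0 : 0 < e' by rewrite divr_gt0 // mulr_gt0.
have [N1 h1] := eps_small e' e'0; have [N2 h2] := hconv e' e'0.
pose n := maxn N1 N2.
have {}h1 := h1 n (leq_maxl _ _); have {}h2 := h2 n (leq_maxr _ _).
have -> : a u g - l g = (a (u_ n) g - l g) + (- a (u_ n - u) g).
  by rewrite bilinear_subl //; ring.
apply: le_trans (sqr2 _ _) _; rewrite sqrrN.
have h3 := B_sqr n g Fg.
have h4 := bilinear_cauchy_schwarz (subspace_sub (Fu n) Fu0) Fg.
have ag0 := a_ge0 Fg.
have h5 : a g g * eps n <= (a g g + 1) * e'.
  by apply: ler_pM => //; [rewrite /eps|rewrite lerDl|exact: ltW].
have h6 : a (u_ n - u) (u_ n - u) * a g g <= e' * (a g g + 1).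
  by apply: ler_pM; rewrite ?a_ge0 //; [exact: subspace_sub|exact: ltW|rewrite lerDl].
have h7 : 2 * K' * e' = e by rewrite /e' mulrC divfK // gt_eqF // mulr_gt0.
move: h3 h4 h5 h6 h7; rewrite /K'; clear; move: e' (eps n) => e' en; lra.
Qed.

End riesz.

(** * Square integrable functions *)

Section L2_inner_product.
Context (d : measure_display) (R : realType) (X : borelMetricType d R).
Variable mu : {measure set X -> \bar R}.
Implicit Types f g h : X -> R.
Local Notation L2 := (Lfun mu 2%:E).
Local Notation ip := (inner2 mu).

Lemma mem_L2P f : measurable_fun setT f ->
  f \in L2 <-> (\int[mu]_x (f x ^+ 2)%:E < +oo)%E.
Proof.
move=> mf; rewrite (mem_LfunP mu _ mf) //.
suff -> : (\int[mu]_x (`|f x| `^ 2)%:E = \int[mu]_x (f x ^+ 2)%:E)%E by [].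
by apply: eq_integral => x _; rewrite powR_mulrn // real_normK ?num_real.
Qed.

Let one_le_two : (1 <= 2%:E :> \bar R)%E. Proof. by rewrite lee_fin ler1n. Qed.

Lemma L2_lin (a : R) f g : f \in L2 -> g \in L2 -> (fun x => a * f x + g x) \in L2.
Proof. by move=> f2 g2; have [_] := Lfun_submod_closed mu one_le_two; exact. Qed.

Lemma L2_0 : cst 0 \in L2.
Proof. by have [] := Lfun_submod_closed mu one_le_two. Qed.

Lemma L2_add f g : f \in L2 -> g \in L2 -> (f \+ g) \in L2.
Proof.
move=> f2 g2; have := L2_lin 1 f2 g2.
by rewrite (_ : (fun _ => _) = f \+ g) //; apply/funext => x; rewrite mul1r.
Qed.

Lemma L2_scale (a : R) f : f \in L2 -> (fun x => a * f x) \in L2.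
Proof.
move=> f2; have := L2_lin a f2 L2_0.
by rewrite (_ : (fun _ => _) = (fun x => a * f x)) //; apply/funext => x; rewrite addr0.
Qed.

Lemma L2_sub f g : f \in L2 -> g \in L2 -> (f \- g) \in L2.
Proof.
move=> f2 g2; have := L2_lin (- 1) g2 f2.
by rewrite (_ : (fun _ => _) = f \- g) //; apply/funext => x; rewrite mulN1r addrC.
Qed.

Lemma L2_le f g : measurable_fun setT f -> g \in L2 -> (forall x, `|f x| <= `|g x|) ->
  f \in L2.
Proof.
move=> mf g2 fg; have mg := Lfun_measurable g2.
apply/(mem_L2P mf); apply: le_lt_trans ((mem_L2P mg).1 g2).
apply: ge0_le_integral_lower => x _; rewrite lee_fin ?sqr_ge0 //.
by rewrite -(real_normK (num_real (f x))) -(real_normK (num_real (g x))) lerXn2r ?nnegrE.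
Qed.

Lemma indic_L2 (A : set X) : measurable A -> (mu A < +oo)%E -> (\1_A : X -> R) \in L2.
Proof.
move=> mA Afin; apply/(mem_L2P (measurable_indic mA)); apply: le_lt_trans Afin.
rewrite (eq_integral (fun x => (\1_A x)%:E)) ?integral_indic ?setIT // => x _.
by rewrite indicE; case: (_ \in _); rewrite ?expr1n ?expr0n.
Qed.

Lemma diff_quotient_L2 (h : R) f g l : f \in L2 -> g \in L2 -> l \in L2 ->
  (fun x => (g x - f x) / h - l x) \in L2.
Proof.
move=> f2 g2 l2; have := L2_sub (L2_scale h^-1 (L2_sub g2 f2)) l2.
rewrite (_ : _ \- _ = (fun x => (g x - f x) / h - l x)) //.
by apply/funext => x; rewrite /= mulrC.
Qed.

Lemma L2_mul_integrable f g : f \in L2 -> g \in L2 ->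
  mu.-integrable setT (EFin \o (fun x => f x * g x)).
Proof. by move=> f2 g2; apply/Lfun1_integrable; exact: Lfun2_mul_Lfun1. Qed.

Lemma inner2C f g : ip f g = ip g f.
Proof. by apply: eq_Rintegral => x _; rewrite mulrC. Qed.

Lemma inner2_lin (a : R) f g h : f \in L2 -> g \in L2 -> h \in L2 ->
  ip (fun x => a * f x + g x) h = a * ip f h + ip g h.
Proof.
move=> f2 g2 h2; have fh := L2_mul_integrable f2 h2; have gh := L2_mul_integrable g2 h2.
rewrite /inner2 -RintegralZl // -RintegralD //.
  by apply: eq_Rintegral => x _; ring.
have := L2_mul_integrable (L2_scale a f2) h2.
by rewrite (_ : (fun x => a * f x * h x) = (fun x => a * (f x * h x))) //; apply/funext => x; ring.
Qed.

Lemma inner2_addl f g h : f \in L2 -> g \in L2 -> h \in L2 ->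
  ip (f \+ g) h = ip f h + ip g h.
Proof.
move=> f2 g2 h2; rewrite -(mul1r (ip f h)) -inner2_lin //.
by congr ip; apply/funext => x; rewrite mul1r.
Qed.

Lemma inner2_subl f g h : f \in L2 -> g \in L2 -> h \in L2 ->
  ip (f \- g) h = ip f h - ip g h.
Proof.
move=> f2 g2 h2; rewrite addrC -mulN1r -inner2_lin //.
by congr ip; apply/funext => x; rewrite mulN1r addrC.
Qed.

Lemma inner2_subr f g h : f \in L2 -> g \in L2 -> h \in L2 ->
  ip h (f \- g) = ip h f - ip h g.
Proof. by move=> f2 g2 h2; rewrite inner2C inner2_subl // !(inner2C h). Qed.

Lemma inner2_addr f g h : f \in L2 -> g \in L2 -> h \in L2 ->
  ip h (f \+ g) = ip h f + ip h g.
Proof. by move=> f2 g2 h2; rewrite inner2C inner2_addl // !(inner2C h). Qed.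

Lemma inner2_scalel (a : R) f h : f \in L2 -> h \in L2 ->
  ip (fun x => a * f x) h = a * ip f h.
Proof.
move=> f2 h2; rewrite /inner2 -RintegralZl //; last exact: L2_mul_integrable.
by apply: eq_Rintegral => x _; rewrite mulrA.
Qed.

Lemma inner2_ge0 f : 0 <= ip f f.
Proof. by apply: Rintegral_ge0 => x _; rewrite -expr2 sqr_ge0. Qed.

Lemma inner2E f g : f \in L2 -> g \in L2 ->
  (\int[mu]_x (f x * g x)%:E = (ip f g)%:E)%E.
Proof.
by move=> f2 g2; rewrite fineK //; apply: integrable_fin_num => //; exact: L2_mul_integrable.
Qed.

Lemma inner2_ae f g h : f \in L2 -> g \in L2 -> h \in L2 ->
  f = g %[ae mu] -> ip f h = ip g h.
Proof.
move=> f2 g2 h2 fg; have mf := Lfun_measurable f2; have mg := Lfun_measurable g2.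
have mh := Lfun_measurable h2; congr fine; apply: ae_eq_integral => //.
- by apply/measurable_EFinP; exact: measurable_funM.
- by apply/measurable_EFinP; exact: measurable_funM.
- by apply: filterS fg => x /= /(_ I) ->.
Qed.

Lemma inner2_eq0 f : f \in L2 -> ip f f = 0 -> f = cst 0 %[ae mu].
Proof.
move=> f2 f0; have mf := Lfun_measurable f2.
have mff : measurable_fun setT (fun x => (f x * f x)%:E).
  by apply/measurable_EFinP; exact: measurable_funM.
have : (\int[mu]_x `|(f x * f x)%:E| = 0)%E.
  rewrite -[RHS]/(0%:E) -f0 -inner2E //; apply: eq_integral => x _.
  by rewrite gee0_abs // lee_fin -expr2 sqr_ge0.
move/(ae_eq_integral_abs mu measurableT mff); apply: filterS => x /= /(_ I) [].
by move/eqP; rewrite mulf_eq0 orbb => /eqP ->.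
Qed.

Definition L2norm f : R := Num.sqrt (ip f f).

Lemma L2norm_ge0 f : 0 <= L2norm f. Proof. exact: sqrtr_ge0. Qed.

Lemma L2norm_sqr f : L2norm f ^+ 2 = ip f f.
Proof. by rewrite sqr_sqrtr // inner2_ge0. Qed.

Lemma inner2_cauchy_schwarz f g : f \in L2 -> g \in L2 ->
  `|ip f g| <= L2norm f * L2norm g.
Proof.
move=> f2 g2; rewrite -(@ler_sqr _ `|_|) ?nnegrE ?mulr_ge0 ?L2norm_ge0 //.
rewrite real_normK ?num_real // exprMn !L2norm_sqr.
apply: discriminant_le => [|s]; first exact: inner2_ge0.
have sfg := L2_lin s f2 g2.
suff <- : ip (fun x => s * f x + g x) (fun x => s * f x + g x) =
    ip g g + 2 * s * ip f g + s ^+ 2 * ip f f by exact: inner2_ge0.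
rewrite inner2_lin // (inner2C f) (inner2C g) !inner2_lin // (inner2C g f); ring.
Qed.

Lemma ler_L2normD f g : f \in L2 -> g \in L2 ->
  L2norm (f \+ g) <= L2norm f + L2norm g.
Proof.
move=> f2 g2; rewrite -ler_sqr ?nnegrE ?addr_ge0 ?L2norm_ge0 //.
have h := le_trans (ler_norm _) (inner2_cauchy_schwarz f2 g2).
have fg := L2_add f2 g2.
rewrite L2norm_sqr inner2_addl // !inner2_addr // (inner2C g f) sqrrD !L2norm_sqr.
by move: h; rewrite -mulr_natl; clear; lra.
Qed.

Lemma L2norm_scale (a : R) f : f \in L2 -> L2norm (fun x => a * f x) = `|a| * L2norm f.
Proof.
move=> f2; rewrite /L2norm inner2_scalel //; last exact: L2_scale.
rewrite inner2C inner2_scalel // mulrA -expr2 sqrtrM ?sqr_ge0 //.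
by rewrite sqrtr_sqr.
Qed.

Lemma L2norm_subC f g : L2norm (f \- g) = L2norm (g \- f).
Proof.
by congr Num.sqrt; apply: eq_Rintegral => x _ /=; ring.
Qed.

Lemma L2norm_triangle f g h : f \in L2 -> g \in L2 -> h \in L2 ->
  L2norm (f \- h) <= L2norm (f \- g) + L2norm (g \- h).
Proof.
move=> f2 g2 h2; apply: le_trans (ler_L2normD (L2_sub f2 g2) (L2_sub g2 h2)).
rewrite le_eqVlt; apply/orP; left; apply/eqP; congr L2norm; apply/funext => x /=; ring.
Qed.

Lemma ler_L2normB f g : f \in L2 -> g \in L2 -> L2norm (f \- g) <= L2norm f + L2norm g.
Proof.
move=> f2 g2; have := ler_L2normD f2 (L2_scale (- 1) g2).
rewrite L2norm_scale // normrN1 mul1r.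
rewrite (_ : f \+ _ = f \- g) //; apply/funext => x /=.
by rewrite mulN1r.
Qed.

Lemma L2norm_ae f g : f \in L2 -> g \in L2 -> f = g %[ae mu] -> L2norm f = L2norm g.
Proof.
move=> f2 g2 fg; congr Num.sqrt.
by rewrite (inner2_ae f2 g2 f2 fg) inner2C (inner2_ae f2 g2 g2 fg).
Qed.

Lemma Lnorm2E f : f \in L2 -> ('N[mu]_2%:E[EFin \o f] = (L2norm f)%:E)%E.
Proof.
move=> f2; rewrite unlock /L2norm -powR12_sqrt ?inner2_ge0 // -poweR_EFin -inner2E //.
congr (_ `^ _)%E; apply: eq_integral => x _.
by rewrite /= powR_mulrn // real_normK ?num_real // expr2.
Qed.

End L2_inner_product.

(** * Resolvent of a Dirichlet form *)

Section resolvent.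
Context (d : measure_display) (R : realType) (X : borelMetricType d R).
Variable mu : {measure set X -> \bar R}.
Variables (E : (X -> R) -> (X -> R) -> R) (F : set (X -> R)).
Hypothesis EF : dirichlet_form mu E F.
Implicit Types f g u v w : X -> R.
Local Notation L2 := (Lfun mu 2%:E).
Local Notation ip := (inner2 mu).
Local Notation L2norm := (L2norm mu).

Let F_L2 u : F u -> u \in L2. Proof. exact: (form_domain_L2 EF). Qed.

Let F_lin (s : R) u v : F u -> F v -> F (fun x => s * u x + v x).
Proof. exact: (form_domain_lin EF). Qed.

Let E_lin (s : R) u v w : F u -> F v -> F w ->
  E (fun x => s * u x + v x) w = s * E u w + E v w.
Proof. exact: (form_lin EF). Qed.

Lemma form_domain_sub u v : F u -> F v -> F (u \- v).
Proof.
move=> Fu Fv; have := F_lin (- 1) Fv Fu.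
by rewrite (_ : (fun _ => _) = u \- v) //; apply/funext => x; rewrite mulN1r addrC.
Qed.

Lemma form_subl u v w : F u -> F v -> F w -> E (u \- v) w = E u w - E v w.
Proof.
move=> Fu Fv Fw; rewrite addrC -mulN1r -E_lin //.
by congr E; apply/funext => x; rewrite mulN1r addrC.
Qed.

(** [u = (1 - h L)^-1 f] *)
Definition resolvent_eq (h : R) f u :=
  F u /\ forall g, F g -> ip u g + h * E u g = ip f g.

(** Riesz representation for the form [ip u v + h * E u v], whose Cauchy sequences
are those of the form norm of the domain. *)
Lemma resolvent_exists (h : R) f : 0 < h -> f \in L2 -> exists u, resolvent_eq h f u.
Proof.
move=> h0 f2; pose V : lmodType R := X -> R.
pose a (u v : V) := ip u v + h * E u v.
have Fl (s : R) (u v : V) : F u -> F v -> F (s *: u + v) by exact: F_lin.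
have a_lin (s : R) (u v w : V) : F u -> F v -> F w ->
    a (s *: u + v) w = s * a u w + a v w.
  move=> Fu Fv Fw; rewrite /a.
  have := inner2_lin s (F_L2 Fu) (F_L2 Fv) (F_L2 Fw).
  rewrite -[(fun _ => _)]/(s *: u + v) => ->.
  have := E_lin s Fu Fv Fw; rewrite -[(fun _ => _)]/(s *: u + v) => ->; ring.
have a_sym (u v : V) : F u -> F v -> a u v = a v u.
  by move=> Fu Fv; rewrite /a inner2C (form_sym EF).
have a_ge0 (u : V) : F u -> 0 <= a u u.
  by move=> Fu; rewrite addr_ge0 ?inner2_ge0 // mulr_ge0 ?(form_ge0 EF) // ltW.
have [|||u Fu hu] := @riesz_representation R V F a (form_domain0 EF) Fl
  a_lin a_sym a_ge0 (ip f) (ip f f).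
- move=> s u v Fu Fv; rewrite inner2C (inner2C mu f u) (inner2C mu f v).
  by have := inner2_lin s (F_L2 Fu) (F_L2 Fv) f2.
- move=> u Fu; have u2 := F_L2 Fu; have fu2 := L2_sub u2 f2.
  have := inner2_ge0 mu (u \- f); rewrite inner2_subl // !inner2_subr // (inner2C mu u f).
  have := mulr_ge0 (ltW h0) (form_ge0 EF Fu); rewrite /a; lra.
- move=> u_ Fu hc; pose lo := Num.min 1 h; pose hi := Num.max 1 h.
  have lo0 : 0 < lo by rewrite lt_min ltr01.
  have hi0 : 0 < hi by rewrite lt_max ltr01.
  have lo_le (w : V) : F w -> lo * form1 mu E w <= a w w.
    move=> Fw; rewrite /form1 mulrDr addrC /a; apply: lerD.
      by rewrite ler_piMl ?inner2_ge0 // ge_min lexx.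
    by rewrite ler_wpM2r ?(form_ge0 EF) // ge_min lexx orbT.
  have hi_ge (w : V) : F w -> a w w <= hi * form1 mu E w.
    move=> Fw; rewrite /form1 mulrDr [leRHS]addrC /a; apply: lerD.
      by rewrite ler_peMl ?inner2_ge0 // le_max lexx.
    by rewrite ler_wpM2r ?(form_ge0 EF) // le_max lexx orbT.
  have [e e0|u Fu0 hu] := form_closed EF Fu.
    have [N hN] := hc (lo * e) (mulr_gt0 lo0 e0); exists N => m n mN nN.
    rewrite -(ltr_pM2l lo0); apply: le_lt_trans (hN m n mN nN).
    by apply: lo_le; exact: form_domain_sub.
  exists u => // e e0; move/cvgrPdist_lt : hu => /(_ (e / hi) (divr_gt0 e0 hi0))[N _ hN].
  exists N => n nN; have := hN n nN; rewrite /= sub0r normrN => h1.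
  apply: le_lt_trans (hi_ge _ (form_domain_sub (Fu n) Fu0)) _.
  by rewrite mulrC -ltr_pdivlMr //; apply: le_lt_trans h1; exact: ler_norm.
by exists u; split => // g Fg; exact: hu.
Qed.

Lemma resolvent_lin (h s : R) f f' u u' : f \in L2 -> f' \in L2 ->
  resolvent_eq h f u -> resolvent_eq h f' u' ->
  resolvent_eq h (fun x => s * f x + f' x) (fun x => s * u x + u' x).
Proof.
move=> f2 f2' [Fu hu] [Fu' hu']; split=> [|g Fg]; first exact: F_lin.
have g2 := F_L2 Fg; rewrite (inner2_lin s f2 f2' g2) (inner2_lin s (F_L2 Fu) (F_L2 Fu') g2).
rewrite E_lin // -hu // -hu' //; ring.
Qed.

Lemma resolvent_contraction (h : R) f f' u u' : 0 < h -> f \in L2 -> f' \in L2 ->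
  resolvent_eq h f u -> resolvent_eq h f' u' -> L2norm (u \- u') <= L2norm (f \- f').
Proof.
move=> h0 f2 f2' [Fu hu] [Fu' hu']; have Fw := form_domain_sub Fu Fu'.
have w2 := F_L2 Fw; have ff2 := L2_sub f2 f2'.
have eqw : L2norm (u \- u') ^+ 2 + h * E (u \- u') (u \- u') = ip (f \- f') (u \- u').
  rewrite L2norm_sqr {1}inner2_subl ?F_L2 // form_subl // inner2_subl // -hu // -hu' //.
  ring.
have := le_trans (ler_norm _) (inner2_cauchy_schwarz ff2 w2); rewrite -eqw.
have E0 : 0 <= h * E (u \- u') (u \- u') by rewrite mulr_ge0 ?(form_ge0 EF) // ltW.
have := L2norm_ge0 mu (u \- u'); rewrite le_eqVlt => /predU1P[<- _|n0].
  exact: L2norm_ge0.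
by move=> h1; rewrite -(ler_pM2r n0) -expr2; apply: le_trans h1; rewrite lerDl.
Qed.

(** Completing the square: [u] is the minimizer of
[v |-> L2norm (v \- f) ^+ 2 + h * E v v]. *)
Lemma resolvent_variation (h : R) f u v : 0 < h -> f \in L2 -> resolvent_eq h f u -> F v ->
  L2norm (v \- f) ^+ 2 + h * E v v =
  L2norm (u \- f) ^+ 2 + h * E u u + (L2norm (v \- u) ^+ 2 + h * E (v \- u) (v \- u)).
Proof.
move=> h0 f2 [Fu hu] Fv; have u2 := F_L2 Fu; have v2 := F_L2 Fv.
have Fvu := form_domain_sub Fv Fu.
have e1 := hu _ Fv; have e2 := hu _ Fu.
rewrite !L2norm_sqr !inner2_subl ?L2_sub // !inner2_subr // form_subl //.
rewrite (form_sym EF Fv Fvu) (form_sym EF Fu Fvu) !form_subl // (form_sym EF Fv Fu).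
rewrite (inner2C mu v f) (inner2C mu u f) (inner2C mu v u) -e1 -e2; ring.
Qed.

Lemma resolvent_approx (h : R) f u v : 0 < h -> f \in L2 -> resolvent_eq h f u -> F v ->
  L2norm (u \- f) ^+ 2 <= L2norm (v \- f) ^+ 2 + h * E v v.
Proof.
move=> h0 f2 hu Fv; rewrite (resolvent_variation h0 f2 hu Fv); case: hu => Fu _.
have := mulr_ge0 (ltW h0) (form_ge0 EF Fu).
have := mulr_ge0 (ltW h0) (form_ge0 EF (form_domain_sub Fv Fu)).
have := sqr_ge0 (L2norm (v \- u)); lra.
Qed.

(** Clamping the minimizer to [[0, 1]] increases neither its distance to [f] nor its
energy, so by [resolvent_variation] the clamped function is the minimizer up to a
null set. *)
Lemma resolvent_markov1 (h : R) f : 0 < h -> f \in L2 -> (forall x, 0 <= f x <= 1) ->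
  exists2 u, resolvent_eq h f u & forall x, 0 <= u x <= 1.
Proof.
move=> h0 f2 f01; have [u hu] := resolvent_exists h0 f2; have [Fu _] := hu.
pose v x := Num.min (Num.max (u x) 0) 1.
have [Fv Ev] : F v /\ E v v <= E u u by exact: (form_markov EF Fu).
have u2 := F_L2 Fu; have v2 := F_L2 Fv.
have vf : L2norm (v \- f) <= L2norm (u \- f).
  rewrite ler_wsqrtr // le_Rintegral //.
  - by apply: L2_mul_integrable; exact: L2_sub.
  - by apply: L2_mul_integrable; exact: L2_sub.
  move=> x _ /=; have := f01 x; rewrite /v.
  case: (leP (u x) 0) => [ux|ux]; [rewrite min_l //|case: (leP (u x) 1) => ux1].
  - by nra.
  - by [].
  - by nra.
have vu0 : ip (v \- u) (v \- u) = 0.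
  apply/eqP; rewrite eq_le inner2_ge0 andbT -L2norm_sqr.
  have := resolvent_variation h0 f2 hu Fv.
  have := mulr_ge0 (ltW h0) (form_ge0 EF (form_domain_sub Fv Fu)).
  have := ler_wpM2l (ltW h0) Ev.
  have : L2norm (v \- f) ^+ 2 <= L2norm (u \- f) ^+ 2.
    by rewrite ler_sqr ?nnegrE ?L2norm_ge0.
  lra.
have vu : v = u %[ae mu].
  by have := inner2_eq0 (L2_sub v2 u2) vu0; apply: filterS => x /= /(_ I) /eqP;
    rewrite subr_eq0 => /eqP.
exists v.
  split=> // g Fg; rewrite (inner2_ae v2 u2 (F_L2 Fg) vu) (form_ae EF Fv Fu Fg vu).
  by case: hu => _; exact.
move=> x; rewrite /v; case: (leP (u x) 0) => [ux|ux]; first by rewrite min_l ?lexx ?ler01.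
by case: (leP (u x) 1) => ux1; rewrite ?ler01 ?lexx // (ltW ux).
Qed.

Lemma resolvent_markov (h M : R) f : 0 < h -> 0 < M -> f \in L2 ->
  (forall x, 0 <= f x <= M) ->
  exists2 u, resolvent_eq h f u & forall x, 0 <= u x <= M.
Proof.
move=> h0 M0 f2 fM.
have g2 := L2_scale M^-1 f2.
have [|u hu u01] := resolvent_markov1 h0 g2.
  move=> x; have /andP[f0 fM1] := fM x.
  by rewrite mulr_ge0 ?invr_ge0 ?(ltW M0) //= mulrC ler_pdivrMr // mul1r.
have o2 : (cst 0 : X -> R) \in L2 by exact: L2_0.
have h00 : resolvent_eq h (cst 0) (cst 0).
  split=> [|g Fg]; first exact: (form_domain0 EF).
  have := E_lin (-1) (form_domain0 EF) (form_domain0 EF) Fg.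
  rewrite (_ : (fun _ => _) = cst 0); last by apply/funext => x /=; rewrite mulr0 addr0.
  by move=> ->; rewrite mulN1r addNr mulr0 addr0.
have := resolvent_lin M g2 o2 hu h00.
rewrite (_ : (fun x => M * (M^-1 * f x) + cst 0 x) = f); last first.
  by apply/funext => x /=; rewrite addr0 mulrA mulfV ?mul1r // gt_eqF.
move=> hMu; exists (fun x => M * u x + cst 0 x) => // x /=.
have /andP[u0 u1] := u01 x; rewrite addr0 mulr_ge0 ?(ltW M0) //=.
by rewrite -[leRHS]mulr1 ler_pM2l.
Qed.

Lemma resolvent_generator (h : R) f u : 0 < h -> f \in L2 -> resolvent_eq h f u ->
  form_generator mu E F u (fun x => h^-1 * (u x - f x)).
Proof.
move=> h0 f2 [Fu hu]; have u2 := F_L2 Fu; have uf2 := L2_sub u2 f2.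
split=> //; first exact: (L2_scale h^-1 uf2).
move=> g Fg; have g2 := F_L2 Fg.
rewrite (inner2_scalel h^-1 uf2 g2) inner2_subl // -hu //.
by field; rewrite gt_eqF.
Qed.

Lemma generator_resolvent (h : R) u l : form_generator mu E F u l ->
  resolvent_eq h (fun x => (- h) * l x + u x) u.
Proof.
move=> [Fu l2 hu]; split=> // g Fg; rewrite (inner2_lin (- h) l2 (F_L2 Fu) (F_L2 Fg)) hu //; ring.
Qed.

End resolvent.

(** * Sub-Markov property of the heat semigroup *)

Section L2_limits.
Context (d : measure_display) (R : realType) (X : borelMetricType d R).
Variable mu : {measure set X -> \bar R}.
Local Notation L2 := (Lfun mu 2%:E).
Local Notation L2norm := (L2norm mu).

Lemma at_right0P (Q : R -> Prop) :
  (\forall h \near 0^'+, Q h) <->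
  exists2 e : R, 0 < e & forall h, 0 < h -> h < e -> Q h.
Proof.
split=> [[e /= e0 he]|[e e0 he]].
  exists e => // h h0 hle; apply: he => //=.
  by rewrite sub0r normrN gtr0_norm.
exists e => //= h; rewrite /= sub0r normrN => hle h0; apply: he => //.
exact: le_lt_trans (ler_norm _) hle.
Qed.

Lemma L2_cvg0P (w : R -> X -> R) : (forall h, 0 < h -> w h \in L2) ->
  (('N[mu]_2%:E[EFin \o w h])%E @[h --> 0^'+] --> 0%E) <->
  (forall e : R, 0 < e -> exists2 r : R, 0 < r &
     forall h, 0 < h -> h < r -> L2norm (w h) < e).
Proof.
move=> w2; split=> [/fine_cvgP[_ /cvgrPdist_lt wc] e e0|wc].
  have /at_right0P[r r0 hr] := wc e e0; exists r => // h h0 hlr.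
  have := hr h h0 hlr; rewrite /= sub0r normrN Lnorm2E ?w2 //=.
  exact: le_lt_trans (ler_norm _).
apply/fine_cvgP; split.
  by apply/at_right0P; exists 1 => // h h0 _; rewrite Lnorm2E ?w2.
apply/cvgrPdist_lt => e e0; have [r r0 hr] := wc e e0.
apply/at_right0P; exists r => // h h0 hlr.
rewrite /= sub0r normrN Lnorm2E ?w2 //= ger0_norm ?L2norm_ge0 //.
exact: hr.
Qed.

End L2_limits.

Section sub_markov.
Context (d : measure_display) (R : realType) (X : borelMetricType d R).
Variable mu : {measure set X -> \bar R}.
Variables (E : (X -> R) -> (X -> R) -> R) (F : set (X -> R)).
Variable P : R -> (X -> R) -> (X -> R).
Hypothesis EF : dirichlet_form mu E F.
Hypothesis P_heat : heat_semigroup mu E F P.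
Implicit Types f g u v w l : X -> R.
Local Notation L2 := (Lfun mu 2%:E).
Local Notation ip := (inner2 mu).
Local Notation L2norm := (L2norm mu).

Let PS : L2_semigroup mu P := P_heat.1.

Let P_L2 (t : R) f : 0 < t -> f \in L2 -> P t f \in L2.
Proof. exact: (sg_L2 PS). Qed.

Lemma heat_contraction (t : R) f : 0 < t -> f \in L2 -> L2norm (P t f) <= L2norm f.
Proof.
by move=> t0 f2; have := sg_contraction PS t0 f2; rewrite !Lnorm2E ?P_L2 // lee_fin.
Qed.

Lemma heat_sub (t : R) f g : 0 < t -> f \in L2 -> g \in L2 ->
  P t (f \- g) = (P t f \- P t g) %[ae mu].
Proof.
move=> t0 f2 g2; have := sg_lin PS (- 1) t0 g2 f2.
rewrite (_ : (fun y => _) = f \- g); last by apply/funext => y; rewrite mulN1r addrC.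
by apply: filterS => x -> _; rewrite /= mulN1r addrC.
Qed.

Lemma heat_scale (t a : R) f : 0 < t -> f \in L2 ->
  P t (fun x => a * f x) = (fun x => a * P t f x) %[ae mu].
Proof.
move=> t0 f2; have := sg_lin PS (a - 1) t0 f2 f2.
rewrite (_ : (fun y => _) = (fun y => a * f y)); last by apply/funext => y; ring.
by apply: filterS => x -> _; ring.
Qed.

Lemma heat_comm (s t : R) f : 0 < s -> 0 < t -> f \in L2 ->
  P s (P t f) = P t (P s f) %[ae mu].
Proof.
move=> s0 t0 f2; have h1 := sg_add PS s0 t0 f2; have h2 := sg_add PS t0 s0 f2.
rewrite addrC in h2.
by apply: filterS2 h1 h2 => x /= /(_ I) <- /(_ I) <-.
Qed.

(** The semigroup maps the domain of the generator to itself and commutes with it: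
the difference quotients commute with the contraction [P t]. *)
Lemma heat_generator (t : R) u l : 0 < t ->
  form_generator mu E F u l -> form_generator mu E F (P t u) (P t l).
Proof.
move=> t0 /P_heat.2[u2 l2 hc]; apply/P_heat.2; split; try exact: P_L2.
pose w (h : R) := (fun x => (P h u x - u x) / h - l x)%R.
have w2 (h : R) : 0 < h -> w h \in L2.
  by move=> h0; apply: diff_quotient_L2 => //; exact: P_L2.
have w2' (h : R) : 0 < h -> (fun x => (P h (P t u) x - P t u x) / h - P t l x)%R \in L2.
  by move=> h0; apply: diff_quotient_L2; rewrite ?P_L2.
apply/(L2_cvg0P w2') => e e0; have [r r0 hr] := (L2_cvg0P w2).1 hc e e0.
exists r => // h h0 hlr; apply: le_lt_trans (hr h h0 hlr).
apply: le_trans (heat_contraction t0 (w2 h h0)).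
rewrite le_eqVlt; apply/orP; left; apply/eqP; apply: L2norm_ae => //.
- exact: w2'.
- exact: P_L2 t0 (w2 h h0).
have pu2 := L2_sub (P_L2 h0 u2) u2.
have wE : w h = (fun x => h^-1 * (P h u \- u) x) \- l.
  by apply/funext => x; rewrite /w /= mulrC.
rewrite wE.
have a1 := heat_sub t0 (L2_scale h^-1 pu2) l2.
have a2 := heat_scale h^-1 t0 pu2.
have a3 := heat_sub t0 (P_L2 h0 u2) u2.
have a4 := heat_comm h0 t0 u2.
apply: filterS (filterI (filterI a1 a2) (filterI a3 a4)) => x [[b1 b2] [b3 b4]] _.
rewrite (b1 I) /= (b2 I) (b3 I) /= (b4 I) mulrC //.
Qed.

Definition between01 (y : X -> R) := forall x, 0 <= y x <= 1.

(** One step of the implicit Euler scheme.  If [x] is close to [y] with values in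
[[0, 1]] and [x'] solves [x' - h L x' = x] up to [r], then [x'] is within [q + r] of
the resolvent of [y], which again takes its values in [[0, 1]]. *)
Let step (h r q : R) x x' l' y : 0 < h -> x \in L2 -> y \in L2 -> between01 y ->
  form_generator mu E F x' l' -> L2norm (((fun z => (- h) * l' z + x' z)) \- x) <= r ->
  L2norm (x \- y) <= q ->
  exists y', [/\ y' \in L2, between01 y' & L2norm (x' \- y') <= q + r].
Proof.
move=> h0 x2 y2 y01 gx' hr hq.
have [u hu u01] := resolvent_markov1 EF h0 y2 y01.
have hx' := generator_resolvent EF h gx'.
have [Fx' l2' _] := gx'; have x2' := form_domain_L2 EF Fx'.
have z2 := L2_lin (- h) l2' x2'.
exists u; split => //; first exact: form_domain_L2 EF _ hu.1.
apply: le_trans (resolvent_contraction EF h0 z2 y2 hx' hu) _.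
apply: le_trans (L2norm_triangle z2 x2 y2) _.
by rewrite addrC lerD.
Qed.

(** [P t f] is reached from [f] by [n] steps of size [h = t / n].  For [f] in the
domain of the generator each step has an error [o(h)], which by contractivity is
the error of the first one, so the errors add up to at most [e]. *)
Lemma heat_near_between01_generator (t e : R) f l : 0 < t -> 0 < e ->
  form_generator mu E F f l -> between01 f ->
  exists y, [/\ y \in L2, between01 y & L2norm (P t f \- y) <= e].
Proof.
move=> t0 e0 gf f01; have [f2 l2 fc] := (P_heat.2 f l).2 gf.
pose w (h : R) := (fun x => (P h f x - f x) / h - l x)%R.
have w2 (h : R) : 0 < h -> w h \in L2.
  by move=> h0; apply: diff_quotient_L2 => //; exact: P_L2.
have et0 : 0 < e / (2 * t) by rewrite divr_gt0 // mulr_gt0.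
have [r1 r10 hr1] := (L2_cvg0P w2).1 fc _ et0.
have w2' (h : R) : 0 < h -> (P h l \- l)%R \in L2 by move=> h0; rewrite L2_sub ?P_L2.
have [r2 r20 hr2] := (L2_cvg0P w2').1 (sg_continuous PS l2) _ et0.
(* large enough for [h = t / n] to be below [r1] and [r2] *)
pose n := (Num.truncn (t / Num.min r1 r2)).+1; pose h := t / n%:R.
have r0 : 0 < Num.min r1 r2 by rewrite lt_min r10.
have n0 : 0 < n%:R :> R by rewrite ltr0n.
have h0 : 0 < h by rewrite divr_gt0.
have hr : h < Num.min r1 r2.
  by rewrite /h ltr_pdivrMr // -ltr_pdivrMl // mulrC; exact: real_truncnS_gt (num_real _).
have [hlr1 hlr2] : h < r1 /\ h < r2 by move: hr; rewrite lt_min => /andP[].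
pose r := h * (e / t).
(* the difference quotient of [f] and [P h l] are both within [e / (2 * t)] of [l] *)
have base : L2norm (((fun z => (- h) * P h l z + P h f z)) \- f) <= r.
  have Pl2 := P_L2 h0 l2.
  have s2 := L2_sub (w2 h h0) (w2' h h0).
  have -> : (fun z => (- h) * P h l z + P h f z) \- f = (fun z => h * (w h \- (P h l \- l)) z).
    by apply/funext => z; rewrite /w /=; field; rewrite gt_eqF.
  rewrite L2norm_scale // gtr0_norm // ler_pM2l //.
  apply: le_trans (ler_L2normB (w2 h h0) (w2' h h0)) _.
  have q1 := hr1 h h0 hlr1; have q2 := hr2 h h0 hlr2.
  have -> : e / t = e / (2 * t) + e / (2 * t) by field; rewrite gt_eqF.
  by apply: lerD; apply: ltW.
suff main k : exists y, [/\ y \in L2, between01 y &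
    L2norm (P (k.+1%:R * h) f \- y) <= k.+1%:R * r].
  have [y [y2 y01 hy]] := main n.-1; exists y; split=> //; move: hy.
  rewrite prednK // (_ : n%:R * h = t); last by rewrite /h mulrC divfK // gt_eqF.
  rewrite (_ : n%:R * r = e) //; rewrite /r /h; field.
  by rewrite !gt_eqF.
elim: k => [|k [y [y2 y01 hy]]].
  have [||y [y2 y01 hy]] := @step h r 0 f (P h f) (P h l) f h0 f2 f2 f01 _ base.
  - exact: heat_generator.
  - rewrite (_ : f \- f = (fun x => 0 * f x)) ?L2norm_scale ?normr0 ?mul0r //.
    by apply/funext => x; rewrite /= subrr mul0r.
  by exists y; rewrite !mul1r; rewrite add0r in hy.
have k0 : 0 < k.+1%:R * h by rewrite mulr_gt0 // ltr0n.
have k0' : 0 < k.+2%:R * h by rewrite mulr_gt0 // ltr0n.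
have [||y' [y2' y01' hy']] := @step h r _ (P (k.+1%:R * h) f) (P (k.+2%:R * h) f)
    (P (k.+2%:R * h) l) y h0 (P_L2 k0 f2) y2 y01 _ _ hy.
- exact: heat_generator.
- have Pl2 := P_L2 h0 l2; have Pf2 := P_L2 h0 f2.
  have z2 := L2_lin (- h) Pl2 Pf2.
  apply: le_trans base; apply: le_trans (heat_contraction k0 (L2_sub z2 f2)).
  rewrite le_eqVlt; apply/orP; left; apply/eqP; apply: L2norm_ae.
  + by apply: L2_sub; rewrite ?P_L2 //; apply: L2_lin; exact: P_L2.
  + by apply: P_L2 => //; exact: L2_sub.
  have kE : k.+2%:R * h = k.+1%:R * h + h by rewrite -[k.+2]addn1 natrD mulrDl mul1r.
  have a1 := heat_sub k0 z2 f2; have a2 := sg_lin PS (- h) k0 Pl2 Pf2.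
  have a3 := sg_add PS k0 h0 l2; have a4 := sg_add PS k0 h0 f2.
  apply: filterS (filterI (filterI a1 a2) (filterI a3 a4)) => x [[b1 b2] [b3 b4]] _.
  by rewrite (b1 I) /= b2 kE (b3 I) (b4 I).
exists y'; split=> //; apply: le_trans hy' _.
by rewrite -[in leRHS](addn1 k.+1) natrD mulrDl mul1r.
Qed.

(** The minimizer is compared with a fixed element [w] of the dense domain, whose
energy has weight [h]. *)
Lemma resolvent_dense f (e : R) : 0 < e -> f \in L2 -> exists2 h : R, 0 < h &
  forall u, resolvent_eq mu E F h f u -> L2norm (u \- f) <= e.
Proof.
move=> e0 f2; have [w Fw hw] := form_domain_dense EF f2 (ltac:(by rewrite divr_gt0) : 0 < e / 2).
have w2 := form_domain_L2 EF Fw.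
rewrite Lnorm2E ?L2_sub // lte_fin L2norm_subC in hw.
have Ew0 := form_ge0 EF Fw.
(* [+ 1] because [E w w] may vanish *)
pose h := e ^+ 2 / (2 * (E w w + 1)).
have Ep : 0 < E w w + 1 by rewrite ltr_wpDl.
have h0 : 0 < h by rewrite divr_gt0 ?exprn_gt0 // mulr_gt0.
exists h => // u hu; rewrite -ler_sqr ?nnegrE ?L2norm_ge0 ?(ltW e0) //.
apply: le_trans (resolvent_approx EF h0 f2 hu Fw) _.
have h1 : L2norm (w \- f) ^+ 2 <= (e / 2) ^+ 2.
  by rewrite ler_sqr ?nnegrE ?L2norm_ge0 ?(ltW hw) // divr_ge0 // ltW.
have h2 : h * E w w <= e ^+ 2 / 2.
  have -> : e ^+ 2 / 2 = h * (E w w + 1) by rewrite /h; field; rewrite gt_eqF.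
  by rewrite ler_pM2l // lerDl.
by move: (sqr_ge0 e) h1 h2; rewrite !expr2; clear; move: (L2norm _ * _) (h * _) => A B; lra.
Qed.

Lemma heat_near_between01 (t e : R) f : 0 < t -> 0 < e -> f \in L2 -> between01 f ->
  exists y, [/\ y \in L2, between01 y & L2norm (P t f \- y) <= e].
Proof.
move=> t0 e0 f2 f01; have e2 : 0 < e / 2 by rewrite divr_gt0.
have [h h0 hh] := resolvent_dense e2 f2.
have [u hu u01] := resolvent_markov1 EF h0 f2 f01; have u2 := form_domain_L2 EF hu.1.
have gu := resolvent_generator EF h0 f2 hu.
have [y [y2 y01 hy]] := heat_near_between01_generator t0 e2 gu u01.
exists y; split=> //; have Pf2 := P_L2 t0 f2; have Pu2 := P_L2 t0 u2.
apply: le_trans (L2norm_triangle Pf2 Pu2 y2) _.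
rewrite (splitr e); apply: lerD => //.
apply: le_trans (hh u hu); rewrite [leRHS]L2norm_subC.
apply: le_trans (heat_contraction t0 (L2_sub f2 u2)).
rewrite le_eqVlt; apply/orP; left; apply/eqP; apply: L2norm_ae.
- exact: L2_sub.
- by apply: P_L2 => //; exact: L2_sub.
by apply: filterS (heat_sub t0 f2 u2) => x h1 _; rewrite (h1 I).
Qed.

(** [P t f] is within every distance of the functions with values in [[0, 1]], and
clamping it is at most as far from it as any of them. *)
Lemma heat_sub_markov (t : R) f : 0 < t -> f \in L2 -> between01 f ->
  \forall x \ae mu, 0 <= P t f x <= 1.
Proof.
move=> t0 f2 f01; have g2 := P_L2 t0 f2; set g := P t f in g2 *.
have mg := Lfun_measurable g2.
pose v x := Num.min (Num.max (g x) 0) 1.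
have mv : measurable_fun setT v by apply: measurable_minr => //; exact: measurable_maxr.
have v2 : v \in L2.
  apply: (L2_le mv g2) => x; rewrite /v.
  case: (leP (g x) 0) => gx; first by rewrite min_l ?normr0.
  by case: (leP (g x) 1) => g1 //; rewrite normr1 gtr0_norm // ltW.
have gv0 : ip (g \- v) (g \- v) = 0.
  rewrite -L2norm_sqr; apply/eqP; rewrite sqrf_eq0 eq_le L2norm_ge0 andbT.
  apply/ler_addgt0Pl => e e0; rewrite addr0.
  have [y [y2 y01 hy]] := heat_near_between01 t0 e0 f2 f01.
  apply: le_trans hy; rewrite ler_wsqrtr // le_Rintegral //.
  - by apply: L2_mul_integrable; exact: L2_sub.
  - by apply: L2_mul_integrable; exact: L2_sub.
  move=> x _ /=; rewrite -/g; have /andP[y0 y1] := y01 x; rewrite /v.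
  case: (leP (g x) 0) => gx; first by rewrite min_l //; nra.
  by have := sqr_ge0 (g x - y x); case: (leP (g x) 1) => g1; nra.
have := inner2_eq0 (L2_sub g2 v2) gv0.
apply: filterS => x /= /(_ I) /eqP; rewrite subr_eq0 => /eqP ->; rewrite /v.
case: (leP (g x) 0) => gx; first by rewrite min_l ?lexx ?ler01.
by case: (leP (g x) 1) => g1; rewrite ?ler01 ?lexx // (ltW gx).
Qed.

End sub_markov.

(** * Heat energy of bounded functions *)

Section heat_energy.
Context (d : measure_display) (R : realType) (X : borelMetricType d R).
Variable mu : {measure set X -> \bar R}.
Variables (E : (X -> R) -> (X -> R) -> R) (F : set (X -> R)).
Variable P : R -> (X -> R) -> (X -> R).
Variables (pt : R -> X -> X -> R).
Hypothesis EF : dirichlet_form mu E F.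
Hypothesis P_heat : heat_semigroup mu E F P.
Hypothesis rel_compact : forall (x : X) (r : R), compact (closure (ball x r)).
Hypothesis pt_continuous :
  forall t : R, 0 < t -> continuous (fun z : X * X => pt t z.1 z.2).
Hypothesis pt_ge0 : forall (t : R) (x y : X), 0 < t -> 0 <= pt t x y.
Hypothesis pt_bounded : forall t : R, 0 < t -> forall x, exists M : R, forall y, pt t x y <= M.
Hypothesis P_kernel : forall (t : R) f, 0 < t -> f \in Lfun mu 2%:E ->
  P t f = kernel_op mu pt t f %[ae mu].
Variable B : nat -> set X.
Hypothesis mB : forall n, measurable (B n).
Hypothesis B_fin : forall n, (mu (B n) < +oo)%E.
Hypothesis B_nd : {homo B : n m / (n <= m)%N >-> n `<=` m}.
Hypothesis B_cover : \bigcup_n B n = setT.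
Implicit Types f g u v w l : X -> R.
Local Notation L2 := (Lfun mu 2%:E).
Local Notation ip := (inner2 mu).
Local Notation L2norm := (L2norm mu).

Let sfmu : sigma_finite setT mu.
Proof. by exists B => // n; split. Qed.

Let chi n : X -> R := \1_(B n).

Let chi01 n : between01 (chi n).
Proof. by move=> x; rewrite /chi indicE; case: (_ \in _); rewrite ?lexx ?ler01. Qed.

Let mchi n : measurable_fun setT (chi n).
Proof. exact: measurable_indic. Qed.

Let chi_L2 n : chi n \in L2. Proof. exact: indic_L2. Qed.

Let P_L2 (t : R) f : 0 < t -> f \in L2 -> P t f \in L2.
Proof. exact: (sg_L2 P_heat.1). Qed.

Let chi_eventually x : \forall n \near \oo, chi n x = 1.
Proof.
have : (\bigcup_n B n) x by rewrite B_cover.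
case=> N _ BNx; exists N => // n /= Nn; rewrite /chi indicE mem_set //.
exact: B_nd Nn _ BNx.
Qed.

Lemma exhaustion_integral_le (g : X -> R) (M : \bar R) :
  measurable_fun setT g -> (forall x, 0 <= g x) ->
  (forall n, (\int[mu]_x (chi n x * g x)%:E <= M)%E) -> (\int[mu]_x (g x)%:E <= M)%E.
Proof.
move=> mg g0 hM; pose gn n x := (chi n x * g x)%:E.
have gn0 n x : (0 <= gn n x)%E by rewrite lee_fin mulr_ge0 //; case/andP: (chi01 n x).
have gnd x : {homo gn ^~ x : n m / (n <= m)%N >-> (n <= m)%E}.
  move=> n m nm; rewrite lee_fin ler_wpM2r // /chi !indicE.
  have [xn|] := boolP (x \in B n); last by case: (_ \in _).
  by rewrite (mem_set (B_nd nm (set_mem xn))).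
have -> : (\int[mu]_x (g x)%:E = \int[mu]_x limn (gn ^~ x))%E.
  apply: eq_integral => x _; apply/esym/cvg_lim => //.
  apply: (@cvg_trans _ (cst (g x)%:E n @[n --> \oo])); last exact: cvg_cst.
  apply: near_eq_cvg; near=> n; rewrite /gn /= (_ : chi n x = 1) ?mul1r //.
  by near: n; exact: chi_eventually.
rewrite monotone_convergence //; last first.
  by move=> n; apply/measurable_EFinP; exact: measurable_funM.
apply: lime_le; last exact: nearW.
apply: ereal_nondecreasing_is_cvgn => n m nm.
by apply: ge0_le_integral_lower => x _ //; exact: gnd.
Unshelve. all: by end_near. Qed.

Let mpt t : 0 < t -> measurable_fun setT (fun z : X * X => pt t z.1 z.2).
Proof. by move=> t0; apply: (continuous_product_borel rel_compact); exact: pt_continuous. Qed.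

Let mpt1 t x : 0 < t -> measurable_fun setT (pt t x).
Proof. by move=> t0; exact: (measurable_fun_pair2 x (mpt t0)). Qed.

(** The total mass is the increasing limit of [P t] on the indicators of the
exhausting sets. *)
Lemma heat_mass_le1 (t : R) : 0 < t ->
  \forall x \ae mu, (\int[mu]_y (pt t x y)%:E <= 1)%E.
Proof.
move=> t0.
have : \forall x \ae mu, forall n, kernel_op mu pt t (chi n) x <= 1.
  apply: ae_foralln => n.
  have h1 := heat_sub_markov EF P_heat t0 (chi_L2 n) (chi01 n).
  by apply: filterS2 h1 (P_kernel t0 (chi_L2 n)) => x /andP[_ +] /(_ I) <-.
apply: filterS => x hx; apply: exhaustion_integral_le => [||n].
- exact: mpt1.
- by move=> y; exact: pt_ge0.
have := hx n; rewrite /kernel_op /Rintegral -lee_fin fineK; last first.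
  rewrite ge0_fin_numE; last first.
    by apply: integral_ge0 => y _; rewrite lee_fin mulr_ge0 ?pt_ge0 //; case/andP: (chi01 n y).
  have [M hM] := pt_bounded t0 x.
  apply: (@le_lt_trans _ _ (\int[mu]_y (`|M|%:E * (chi n y)%:E))%E).
    apply: ge0_le_integral_lower => y _.
      by rewrite lee_fin mulr_ge0 ?pt_ge0 //; case/andP: (chi01 n y).
    rewrite -EFinM lee_fin; apply: ler_wpM2r; first by case/andP: (chi01 n y).
    exact: le_trans (hM y) (ler_norm _).
  rewrite ge0_integralZl_EFin //; last 2 first.
  - by move=> y _; rewrite lee_fin; case/andP: (chi01 n y).
  - exact/measurable_EFinP.
  by rewrite integral_indic // setIT lte_mul_pinfty.
by congr (_ <= _)%E; apply: eq_integral => y _; rewrite mulrC.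
Qed.

(** By symmetry, the integral of [P t g] over an exhausting set is the integral of
[g] against [P t] of its indicator, which is at most 1.  The positive part
guards against negative values of [P t g] on a null set. *)
Lemma heat_L1_contraction (t : R) g : 0 < t -> g \in L2 -> (forall x, 0 <= g x) ->
  (\int[mu]_x (Num.max (P t g x) 0)%:E <= \int[mu]_x (g x)%:E)%E.
Proof.
move=> t0 g2 g0; have Pg2 := P_L2 t0 g2; have mPg := Lfun_measurable Pg2.
have mg := Lfun_measurable g2.
have Pg0 : \forall x \ae mu, 0 <= P t g x.
  apply: filterS (P_kernel t0 g2) => x /(_ I) ->.
  by apply: Rintegral_ge0 => y _; rewrite mulr_ge0 // pt_ge0.
apply: exhaustion_integral_le => [||n]; first exact: measurable_maxr.
  by move=> x; rewrite le_max lexx orbT.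
have Pc2 := P_L2 t0 (chi_L2 n).
have -> : (\int[mu]_x (chi n x * Num.max (P t g x) 0)%:E = (ip (chi n) (P t g))%:E)%E.
  rewrite -(inner2E (chi_L2 n) Pg2); apply: ae_eq_integral => //.
  - by apply/measurable_EFinP; apply: measurable_funM => //; exact: measurable_maxr.
  - by apply/measurable_EFinP; exact: measurable_funM.
  - by apply: filterS Pg0 => x Px _; rewrite max_l.
rewrite -(sg_sym P_heat.1 t0 (chi_L2 n) g2) -(inner2E Pc2 g2).
have Pc01 := heat_sub_markov EF P_heat t0 (chi_L2 n) (chi01 n).
apply: (@le_trans _ _ (\int[mu]_x (Num.max (P t (chi n) x) 0 * g x)%:E)%E).
  rewrite le_eqVlt; apply/orP; left; apply/eqP; apply: ae_eq_integral => //.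
  - by apply/measurable_EFinP; apply: measurable_funM => //; exact: Lfun_measurable Pc2.
  - apply/measurable_EFinP; apply: measurable_funM => //; apply: measurable_maxr => //.
    exact: Lfun_measurable Pc2.
  - by apply: filterS Pc01 => x /andP[P0 _] _; rewrite max_l.
apply: ae_ge0_le_integral => //.
- by move=> x _; rewrite lee_fin mulr_ge0 // le_max lexx orbT.
- apply/measurable_EFinP; apply: measurable_funM => //; apply: measurable_maxr => //.
  exact: Lfun_measurable Pc2.
- by move=> x _; rewrite lee_fin.
- exact/measurable_EFinP.
apply: filterS Pc01 => x /andP[P0 P1] _.
by rewrite lee_fin -[leRHS]mul1r ler_wpM2r // max_l.
Qed.

(** Expanding the square gives [f x ^+ 2 * p x + P t (f ^+ 2) x - 2 * f x * P t f x]
for the inner integral, with [p x] the total mass at [x].  The mass is at most 1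
and [P t] does not increase the integral of [f ^+ 2]. *)
Lemma heat_energy_le (t M : R) f : 0 < t -> f \in L2 -> (forall x, `|f x| <= M) ->
  (\int[mu]_x \int[mu]_y ((f x - f y) ^+ 2 * pt t x y)%:E <=
   (2 * (ip f f - ip f (P t f)))%:E)%E.
Proof.
move=> t0 f2 fM; have mf := Lfun_measurable f2.
pose g x := f x ^+ 2; have mg : measurable_fun setT g by exact: measurable_funX.
have g2 : g \in L2.
  apply: (L2_le mg (L2_scale M f2)) => x; rewrite /g normrX normrM expr2.
  by rewrite ler_wpM2r // (le_trans (fM x)) // ler_norm.
have g0 x : 0 <= g x by exact: sqr_ge0.
have Pf2 := P_L2 t0 f2; have Pg2 := P_L2 t0 g2.
have intg : mu.-integrable setT (EFin \o g) by exact: Lfun2_integrable_sqr.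
pose G x := Num.max (P t g x) 0.
have mG : measurable_fun setT G by apply: measurable_maxr => //; exact: Lfun_measurable Pg2.
have G0 x : 0 <= G x by rewrite le_max lexx orbT.
have ig : (\int[mu]_x (g x)%:E = (ip f f)%:E)%E.
  by rewrite -inner2E //; apply: eq_integral => x _; rewrite /g expr2.
have hG : (\int[mu]_x (G x)%:E <= (ip f f)%:E)%E by rewrite -ig; exact: heat_L1_contraction.
have intG : mu.-integrable setT (EFin \o G).
  apply/integrableP; split; first exact/measurable_EFinP.
  rewrite (eq_integral (fun x => (G x)%:E)); last first.
    by move=> x _; rewrite /= ger0_norm.
  exact: le_lt_trans hG (ltry _).
have intfP := L2_mul_integrable f2 Pf2.
pose h x := g x + G x - 2 * (f x * P t f x).
have int2fP : mu.-integrable setT (EFin \o (fun x => 2 * (f x * P t f x))).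
  by have := integrableZl measurableT 2 intfP; apply: eq_integrable.
have intgG : mu.-integrable setT (EFin \o (fun x => g x + G x)).
  by have := integrableD measurableT intg intG; apply: eq_integrable.
have inth : mu.-integrable setT (EFin \o h).
  by have := integrableB measurableT intgG int2fP; apply: eq_integrable.
have hle : \int[mu]_x h x <= 2 * (ip f f - ip f (P t f)).
  rewrite RintegralB // RintegralD // RintegralZl //.
  have -> : \int[mu]_x (g x) = ip f f by rewrite /Rintegral ig.
  have : \int[mu]_x (G x) <= ip f f.
    rewrite -lee_fin [X in (X <= _)%E](_ : _ = (\int[mu]_x (G x)%:E)%E) //.
    by rewrite fineK //; exact: (integrable_fin_num measurableT intG).
  rewrite -[\int[mu]_x (f x * P t f x)]/(ip f (P t f)); lra.
pose k x := (\int[mu]_y ((f x - f y) ^+ 2 * pt t x y)%:E)%E.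
have k0 x : (0 <= k x)%E.
  by apply: integral_ge0 => y _; rewrite lee_fin mulr_ge0 ?sqr_ge0 ?pt_ge0.
have mk : measurable_fun setT k.
  apply: (measurable_integral_section sfmu
     (f := fun z : X * X => ((f z.1 - f z.2) ^+ 2 * pt t z.1 z.2)%:E)).
    apply/measurable_EFinP; apply: measurable_funM; last exact: mpt.
    apply: measurable_funX; apply: measurable_funB.
      exact: (measurableT_comp mf measurable_fst).
    exact: (measurableT_comp mf measurable_snd).
  by move=> z; rewrite lee_fin mulr_ge0 ?sqr_ge0 ?pt_ge0.
have kh : \forall x \ae mu, (k x <= (h x)%:E)%E.
  have ae1 := heat_mass_le1 t0; have ae2 := P_kernel t0 f2; have ae3 := P_kernel t0 g2.
  apply: filterS (filterI ae1 (filterI ae2 ae3)) => x [m1 [b1 b2]].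
  have {}b1 := b1 I; have {}b2 := b2 I.
  have intp : mu.-integrable setT (EFin \o pt t x).
    apply/integrableP; split; first exact/measurable_EFinP/mpt1.
    rewrite (eq_integral (fun y => (pt t x y)%:E)); last first.
      by move=> y _; rewrite /= ger0_norm // pt_ge0.
    exact: le_lt_trans m1 (ltry _).
  have bnd (q : X -> R) (M' : R) : measurable_fun setT q -> (forall y, `|q y| <= M') ->
      mu.-integrable setT (EFin \o (fun y => pt t x y * q y)).
    move=> mq qM; apply: (le_integrable measurableT _ _ (integrableZl measurableT M' intp)).
      by apply/measurable_EFinP; apply: measurable_funM => //; exact: mpt1.
    move=> y _ /=; rewrite lee_fin !normrM mulrC ler_wpM2r //.
    by apply: le_trans (qM y) (ler_norm _).
  have intpf := bnd f M mf fM.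
  have intpg : mu.-integrable setT (EFin \o (fun y => pt t x y * g y)).
    apply: (bnd g (M ^+ 2) mg) => y; rewrite /g normrX lerXn2r ?nnegrE //.
    by apply: le_trans (fM y).
  have i1 : mu.-integrable setT (EFin \o (fun y => g x * pt t x y)).
    by have := integrableZl measurableT (g x) intp; apply: eq_integrable.
  have i2 : mu.-integrable setT (EFin \o (fun y => 2 * f x * (pt t x y * f y))).
    by have := integrableZl measurableT (2 * f x) intpf; apply: eq_integrable.
  have i3 : mu.-integrable setT (EFin \o (fun y => g x * pt t x y + pt t x y * g y)).
    by have := integrableD measurableT i1 intpg; apply: eq_integrable.
  have i4 : mu.-integrable setT (EFin \o (fun y =>
      g x * pt t x y + pt t x y * g y - 2 * f x * (pt t x y * f y))).
    by have := integrableB measurableT i3 i2; apply: eq_integrable.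
  have -> : k x = (\int[mu]_y (g x * pt t x y + pt t x y * g y - 2 * f x * (pt t x y * f y)))%:E.
    rewrite /Rintegral fineK; last exact: (integrable_fin_num measurableT i4).
    by apply: eq_integral => y _; rewrite /g; congr EFin; ring.
  rewrite lee_fin RintegralB // RintegralD // !RintegralZl //.
  rewrite -[\int[mu]_y (pt t x y * f y)]/(kernel_op mu pt t f x) -b1.
  rewrite -[\int[mu]_y (pt t x y * g y)]/(kernel_op mu pt t g x) -b2.
  have mass : \int[mu]_y pt t x y <= 1.
    by rewrite -lee_fin /Rintegral fineK //; exact: (integrable_fin_num measurableT intp).
  rewrite /h mulrA lerD2r lerD //.
    by rewrite -[leRHS]mulr1 ler_wpM2l.
  by rewrite le_max lexx.
apply: (@le_trans _ _ (\int[mu]_x (Num.max (h x) 0)%:E)%E).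
  have mh : measurable_fun setT h by apply/measurable_EFinP; case/integrableP: inth.
  apply: ae_ge0_le_integral => //.
  - by move=> x _; exact: k0.
  - by move=> x _; rewrite lee_fin le_max lexx orbT.
  - by apply/measurable_EFinP; exact: measurable_maxr.
  apply: filterS kh => x khx _; apply: le_trans khx _.
  by rewrite lee_fin le_max lexx.
have -> : (\int[mu]_x (Num.max (h x) 0)%:E = (\int[mu]_x h x)%:E)%E.
  rewrite /Rintegral fineK; last exact: (integrable_fin_num measurableT inth).
  have mh : measurable_fun setT h by apply/measurable_EFinP; case/integrableP: inth.
  apply: ae_eq_integral => //.
  - by apply/measurable_EFinP; exact: measurable_maxr.
  - exact/measurable_EFinP.
  apply: filterS kh => x khx _; rewrite max_l // -lee_fin.
  exact: le_trans (k0 x) khx.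
by rewrite lee_fin.
Qed.

(** [L2norm (u \- P t u)] is at most [2 * L2norm u] by contractivity and [O(t)] on the
domain of the generator. *)
Lemma generator_energy_le (M : R) u l : form_generator mu E F u l ->
  (forall x, `|u x| <= M) ->
  exists2 C : R, 0 < C & forall t, 0 < t ->
   (\int[mu]_x \int[mu]_y ((u x - u y) ^+ 2 * pt t x y)%:E <= (C * t)%:E)%E /\
   (\int[mu]_x \int[mu]_y ((u x - u y) ^+ 2 * pt t x y)%:E <= C%:E)%E.
Proof.
move=> gu uM; have [u2 l2 uc] := (P_heat.2 u l).2 gu.
pose w (h : R) := (fun x => (P h u x - u x) / h - l x)%R.
have w2 (h : R) : 0 < h -> w h \in L2.
  by move=> h0; apply: diff_quotient_L2 => //; exact: P_L2.
have [r r0 hr] := (L2_cvg0P w2).1 uc _ ltr01.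
pose N := L2norm u; pose D := 1 + L2norm l + 2 * N / r.
have N0 : 0 <= N by exact: L2norm_ge0.
have l0 : 0 <= L2norm l by exact: L2norm_ge0.
have D0 : 0 <= D by rewrite !addr_ge0 // divr_ge0 ?mulr_ge0 // ltW.
have two t : 0 < t -> L2norm (u \- P t u) <= 2 * N.
  move=> t0; have Pu2 := P_L2 t0 u2.
  apply: le_trans (ler_L2normB u2 Pu2) _.
  have := heat_contraction P_heat t0 u2; rewrite -/N; lra.
have lin t : 0 < t -> L2norm (u \- P t u) <= D * t.
  move=> t0; have Pu2 := P_L2 t0 u2; have [tr|rt] := ltP t r.
    have e : L2norm (u \- P t u) = t * L2norm (w t \+ l).
      rewrite L2norm_subC -{2}(gtr0_norm t0) -L2norm_scale; last by apply: L2_add => //; exact: w2.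
      by congr (L2norm _); apply/funext => x; rewrite /w /=; field; rewrite gt_eqF.
    rewrite e mulrC ler_pM2r //; apply: le_trans (ler_L2normD (w2 t t0) l2) _.
    have := hr t t0 tr; have : 0 <= 2 * N / r by rewrite divr_ge0 ?mulr_ge0 // ltW.
    rewrite /D; lra.
  apply: le_trans (two t t0) _; rewrite /D mulrDl.
  have h1 : 2 * N <= 2 * N / r * t.
    by rewrite mulrAC ler_pdivlMr // ler_wpM2l // mulr_ge0.
  have : 0 <= (1 + L2norm l) * t by rewrite mulr_ge0 ?addr_ge0 // ltW.
  lra.
pose C := 2 * (N * D) + 4 * (N * N) + 1.
have ND0 : 0 <= N * D by rewrite mulr_ge0.
have NN0 : 0 <= N * N by rewrite mulr_ge0.
have C0 : 0 < C by rewrite /C; lra.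
exists C => // t t0; have Pu2 := P_L2 t0 u2.
have en := heat_energy_le t0 u2 uM.
have cs : ip u u - ip u (P t u) <= N * L2norm (u \- P t u).
  rewrite -inner2_subr //; apply: le_trans (ler_norm _) _.
  exact: inner2_cauchy_schwarz u2 (L2_sub u2 Pu2).
split; apply: le_trans en _; rewrite lee_fin.
  have h1 : N * L2norm (u \- P t u) <= N * D * t by rewrite -mulrA ler_wpM2l // lin.
  have h2 : 0 <= (4 * (N * N) + 1) * t by rewrite mulr_ge0 ?(ltW t0) // addr_ge0 // mulr_ge0.
  by move: cs h1 h2; rewrite /C; move: (ip _ _) (ip _ _) (N * L2norm _) => a b c; lra.
have h1 : N * L2norm (u \- P t u) <= N * (2 * N) by rewrite ler_wpM2l // two.
by move: cs h1 ND0; rewrite /C; move: (ip _ _) (ip _ _) (N * L2norm _) => a b c; lra.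
Qed.

End heat_energy.

(** * From heat energy to the Sobolev seminorm *)

Section dyadic.
Context (d : measure_display) (R : realType) (X : borelMetricType d R).
Variable mu : {measure set X -> \bar R}.
Hypothesis sfmu : sigma_finite setT mu.
Hypothesis rel_compact : forall (x : X) (r : R), compact (closure (ball x r)).
Variables (pt : R -> X -> X -> R) (dH dW delta : R).
Hypothesis pt_continuous :
  forall t : R, 0 < t -> continuous (fun z : X * X => pt t z.1 z.2).
Hypothesis pt_ge0 : forall (t : R) (x y : X), 0 < t -> 0 <= pt t x y.
Variables c5 c6 : R.
Hypotheses (c5_gt0 : 0 < c5) (c6_gt0 : 0 < c6).
Hypothesis pt_lower : forall (t : R) (x y : X), 0 < t -> x != y ->
  c5 * stretched (dH / dW) (dW - 1)^-1 c6 (mdist x y `^ dW) t <= pt t x y.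
Hypotheses (dH_gt0 : 0 < dH) (dW_gt1 : 1 < dW).
Hypotheses (delta_gt0 : 0 < delta) (delta_lt1 : delta < 1).

Let dW_gt0 : 0 < dW. Proof. exact: lt_trans dW_gt1. Qed.

Let beta := dH + delta * dW.

Let beta_gt0 : 0 < beta. Proof. by rewrite addr_gt0 // mulr_gt0. Qed.

Lemma heat_kernel_near_diagonal : exists2 K : R, 0 < K & forall (r : R) (x y : X),
  0 < r -> x != y -> mdist x y <= r -> r `^ (- dH) <= K * pt (r `^ dW) x y.
Proof.
pose k := c5 * expR (- c6); have k0 : 0 < k by rewrite mulr_gt0 // expR_gt0.
exists k^-1 => [|r x y r0 xy xyr]; first by rewrite invr_gt0.
have t0 : 0 < r `^ dW by rewrite powR_gt0.
rewrite mulrC ler_pdivlMr //; apply: le_trans (pt_lower t0 xy).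
rewrite /k mulrCA ler_pM2l // /stretched -powRrM.
have -> : dW * - (dH / dW) = - dH by field; rewrite gt_eqF.
rewrite ler_pM2l ?powR_gt0 // ler_expR lerN2 -[leRHS]mulr1 ler_pM2l //.
have b0 : 0 <= (dW - 1)^-1 by rewrite invr_ge0 subr_ge0 ltW.
have q1 : mdist x y `^ dW / r `^ dW <= 1.
  rewrite ler_pdivrMr // mul1r; apply: ge0_ler_powR; rewrite ?nnegrE ?mdist_ge0 //.
  - exact: ltW.
  - exact: ltW.
have q0 : 0 <= mdist x y `^ dW / r `^ dW by rewrite divr_ge0 ?powR_ge0.
have : (mdist x y `^ dW / r `^ dW) `^ (dW - 1)^-1 <= 1 `^ (dW - 1)^-1.
  by apply: ge0_ler_powR; rewrite ?nnegrE.
by rewrite powR1.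
Qed.

(** At the time [r `^ dW] the heat kernel is of order [r `^ (- dH)] on the pairs at
distance at most [r]. *)
Lemma sobolev_weight_le : exists2 K : R, 0 < K & forall (r : R) (x y : X),
  0 < r -> x != y -> mdist x y <= r -> r / 2 < mdist x y ->
  (mdist x y `^ beta)^-1 <= K * (r `^ (- (delta * dW)) * pt (r `^ dW) x y).
Proof.
have [K K0 hK] := heat_kernel_near_diagonal.
exists (2 `^ beta * K) => [|r x y r0 xy dr rd]; first by rewrite mulr_gt0 // powR_gt0.
have r2 : 0 < r / 2 by rewrite divr_gt0.
apply: (@le_trans _ _ ((r / 2) `^ (- beta))).
  rewrite powRN lef_pV2 ?posrE ?powR_gt0 ?mdist_gt0 //.
  apply: ge0_ler_powR; rewrite ?nnegrE ?mdist_ge0 ?(ltW r2) ?(ltW rd) //.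
  exact: ltW.
rewrite powRM ?invr_ge0 ?(ltW r0) // powR_inv // opprK mulrC.
rewrite -mulrA ler_pM2l ?powR_gt0 // mulrCA /beta opprD addrC.
rewrite powRD; last by rewrite (gt_eqF r0) implybT.
by rewrite ler_pM2l ?powR_gt0 //; exact: hK.
Qed.

(** Nonnegative and nonpositive powers of 2 are indexed separately, so that sums over
all scales are sums over natural numbers. *)
Lemma dyadic_scale (e : R) : 0 < e -> exists j : nat,
  (e <= 2 ^+ j /\ 2 ^+ j / 2 < e) \/ (e <= (2 ^+ j)^-1 /\ (2 ^+ j)^-1 / 2 < e).
Proof.
move=> e0; have pow_ge (n : nat) : n%:R <= 2 ^+ n :> R.
  elim: n => // n IH; rewrite exprS -natr1 mulr_natl mulr2n lerD //.
  by rewrite exprn_ege1 // ler1n.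
have [e1|e1] := leP e 1.
  have ex : exists n, (2 ^+ n)^-1 / 2 < e.
    exists (Num.truncn e^-1).+1; rewrite ltr_pdivrMr //.
    apply: (@lt_trans _ _ e); last by rewrite ltr_pMr // ltr1n.
    rewrite invf_plt ?posrE ?exprn_gt0 //; apply: lt_le_trans (pow_ge _).
    exact: real_truncnS_gt (num_real _).
  case: (ex_minnP ex) => j hj jmin; exists j; right; split=> //.
  case: j hj jmin => [|j] hj jmin; first by rewrite expr0 invr1.
  rewrite leNgt; apply/negP => h.
  have : (2 ^+ j)^-1 / 2 < e by rewrite -invfM -exprSr.
  by move/jmin; rewrite ltnn.
have ex : exists n, e <= 2 ^+ n.
  exists (Num.truncn e).+1; apply: le_trans (pow_ge _); apply: ltW.
  exact: real_truncnS_gt (num_real _).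
case: (ex_minnP ex) => j hj jmin; exists j; left; split=> //.
case: j hj jmin => [|j] hj jmin; first by move: hj; rewrite expr0 leNgt e1.
rewrite exprSr mulfK // ltNge; apply/negP => /jmin; by rewrite ltnn.
Qed.

Lemma geometric_sum_le (q : R) (n : nat) : 0 <= q -> q < 1 ->
  \sum_(j < n) q ^+ j <= (1 - q)^-1.
Proof.
move=> q0 q1; have h := subrX1 q n.
have q1' : 0 < 1 - q by rewrite subr_gt0.
rewrite -[leRHS]mul1r ler_pdivlMr // mulrC.
have : 0 <= q ^+ n by rewrite exprn_ge0.
by move: h; move: (\sum_(j < n) _) (q ^+ n) => s qn; lra.
Qed.

(** On the pairs at distance between [r / 2] and [r] the Sobolev integrand is at most
[Q r], a multiple of [r `^ (- (delta * dW))] times the heat energy density at time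
[r `^ dW].  The bound [C] of the energy serves the scales [r = 2 ^+ j], where the
factor [r `^ (- (delta * dW))] decays; the bound [C * t] serves
[r = (2 ^+ j)^-1], leaving [r `^ ((1 - delta) * dW)]. *)
Lemma bounded_energy_sobolev (p M C : R) (f : X -> R) : 2 <= p -> 0 < M -> 0 < C ->
  measurable_fun setT f -> (forall x, `|f x| <= M) ->
  (forall t, 0 < t ->
   (\int[mu]_x \int[mu]_y ((f x - f y) ^+ 2 * pt t x y)%:E <= (C * t)%:E)%E /\
   (\int[mu]_x \int[mu]_y ((f x - f y) ^+ 2 * pt t x y)%:E <= C%:E)%E) ->
  (\int[mu]_x \int[mu]_y (`|f x - f y| `^ p / mdist x y `^ (dH + delta * dW))%:E < +oo)%E.
Proof.
move=> p2 M0 C0 mf fM en.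
have p0 : 0 < p by apply: lt_le_trans p2.
have [K K0 hK] := sobolev_weight_le; rewrite -/beta.
pose L := (2 * M) `^ (p - 2) * K; have L0 : 0 < L by rewrite mulr_gt0 // powR_gt0 // mulr_gt0.
pose G (z : X * X) := (`|f z.1 - f z.2| `^ p / mdist z.1 z.2 `^ beta)%:E.
have G0 z : (0 <= G z)%E by rewrite lee_fin divr_ge0 ?powR_ge0.
pose e2 (t : R) (z : X * X) := ((f z.1 - f z.2) ^+ 2 * pt t z.1 z.2)%:E.
pose Q (r : R) (z : X * X) := ((L * r `^ (- (delta * dW)))%:E * e2 (r `^ dW)%R z)%E.
have e20 t z : 0 < t -> (0 <= e2 t z)%E.
  by move=> t0; rewrite lee_fin mulr_ge0 ?sqr_ge0 // pt_ge0.
have w0 r : 0 < r -> 0 < L * r `^ (- (delta * dW)) by move=> r0; rewrite mulr_gt0 ?powR_gt0.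
have Q0 r z : 0 < r -> (0 <= Q r z)%E.
  by move=> r0; rewrite mule_ge0 ?e20 ?powR_gt0 // lee_fin ltW // w0.
have mdf : measurable_fun setT (fun z : X * X => f z.1 - f z.2).
  apply: measurable_funB; first exact: (measurableT_comp mf measurable_fst).
  exact: (measurableT_comp mf measurable_snd).
have md : measurable_fun setT (fun z : X * X => mdist z.1 z.2).
  exact: (continuous_product_borel rel_compact (@mdist_continuous _ _ X)).
have me2 t : 0 < t -> measurable_fun setT (e2 t).
  move=> t0; apply/measurable_EFinP; apply: measurable_funM; first exact: measurable_funX.
  by apply: (continuous_product_borel rel_compact); exact: pt_continuous.
have mG : measurable_fun setT G.
  apply/measurable_EFinP; apply: measurable_funM.
    apply: (measurableT_comp (measurable_powR _)); exact: measurableT_comp.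
  have -> : (fun z : X * X => (mdist z.1 z.2 `^ beta)^-1) =
      (fun z : X * X => mdist z.1 z.2 `^ (- beta)) by apply/funext => z; rewrite powRN.
  exact: (measurableT_comp (measurable_powR _)).
have mQ r : 0 < r -> measurable_fun setT (Q r).
  by move=> r0; apply: measurable_funeM; apply: me2; rewrite powR_gt0.
have G_le r x y : 0 < r -> mdist x y <= r -> r / 2 < mdist x y -> (G (x, y) <= Q r (x, y))%E.
  move=> r0 dr rd; have [xy|xy] := eqVneq x y.
    by rewrite {1}/G /= xy subrr normr0 powR0 ?gt_eqF // mul0r Q0.
  rewrite /G /Q /e2 /= -EFinM lee_fin.
  have h1 : `|f x - f y| `^ p <= (2 * M) `^ (p - 2) * (f x - f y) ^+ 2.
    rewrite -(real_normK (num_real (f x - f y))); apply: powR_le_sqr => //.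
    by apply: le_trans (ler_normB _ _) _; have := fM x; have := fM y; lra.
  have h2 := hK r x y r0 xy dr rd.
  apply: le_trans (ler_pM _ _ h1 h2) _; rewrite ?powR_ge0 ?invr_ge0 ?powR_ge0 //.
  by rewrite /L le_eqVlt; apply/orP; left; apply/eqP; ring.
pose pw (j : nat) : R := 2 ^+ j; pose iw (j : nat) : R := (2 ^+ j)^-1.
pose S (j : nat) z := (Q (pw j) z + Q (iw j) z)%E.
have tp j : 0 < pw j by rewrite exprn_gt0.
have tpV j : 0 < iw j by rewrite invr_gt0.
have S0 j z : (0 <= S j z)%E by rewrite adde_ge0 // Q0.
have mS j : measurable_fun setT (S j) by apply: emeasurable_funD; exact: mQ.
pose T (n : nat) z := (\sum_(j < n) S j z)%E.
have T0 n z : (0 <= T n z)%E by apply: sume_ge0 => j _; exact: S0.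
have mT n : measurable_fun setT (T n) by apply: emeasurable_sum => j; exact: mS.
(* [mine (G z) (T n z)] increases to [G z], and is eventually equal to it as one of
   the scales dominates [G z] *)
pose Fn (n : nat) z := mine (G z) (T n z).
have iQ r : 0 < r -> (\int[mu]_x \int[mu]_y Q r (x, y) =
   (L * r `^ (- (delta * dW)))%:E * \int[mu]_x \int[mu]_y e2 (r `^ dW)%R (x, y))%E.
  move=> r0; rewrite -ge0_integralZl_lower ?w0 //; last first.
    by move=> x _; apply: integral_ge0 => y _; rewrite e20 ?powR_gt0.
  apply: eq_integral => x _; rewrite -ge0_integralZl_lower ?w0 // => y _.
  by rewrite e20 ?powR_gt0.
pose q1 : R := 2 `^ (- (delta * dW)); pose q2 : R := 2 `^ (- ((1 - delta) * dW)).
have q_lt1 (s : R) : 0 < s -> 2 `^ (- s) < 1.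
  move=> s0; rewrite powRN invf_lt1 ?powR_gt0 //.
  by have := @gt0_ltr_powR R _ s0 1 2; rewrite powR1; apply; rewrite ?nnegrE // ltr1n.
have q11 : q1 < 1 by apply: q_lt1; rewrite mulr_gt0.
have q21 : q2 < 1 by apply: q_lt1; rewrite mulr_gt0 // subr_gt0.
have powE (s : R) j : pw j `^ s = (2 `^ s) ^+ j.
  by rewrite /pw -powR_mulrn // powRAC powR_mulrn // powR_ge0.
have S_le j : (\int[mu]_x \int[mu]_y S j (x, y) <= (L * C * (q1 ^+ j + q2 ^+ j))%:E)%E.
  have -> : (\int[mu]_x \int[mu]_y S j (x, y) =
     \int[mu]_x \int[mu]_y Q (pw j) (x, y) + \int[mu]_x \int[mu]_y Q (iw j) (x, y))%E.
    rewrite -ge0_integralD //; first last.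
    - by apply: (measurable_integral_section sfmu) => [|z]; [exact: mQ|exact: Q0].
    - by move=> x _; apply: integral_ge0 => y _; exact: Q0.
    - by apply: (measurable_integral_section sfmu) => [|z]; [exact: mQ|exact: Q0].
    - by move=> x _; apply: integral_ge0 => y _; exact: Q0.
    apply: eq_integral => x _; rewrite -ge0_integralD //.
    - by move=> y _; exact: Q0.
    - exact: (measurable_fun_pair2 x (mQ _ _)).
    - by move=> y _; exact: Q0.
    - exact: (measurable_fun_pair2 x (mQ _ _)).
  rewrite (mulrDr (L * C)) EFinD; apply: leeD.
    rewrite (iQ _ (tp j)); have [_ h] := en (pw j `^ dW) (powR_gt0 _ (tp j)).
    apply: (@le_trans _ _ ((L * pw j `^ (- (delta * dW)))%:E * C%:E)%E).
      by apply: lee_wpmul2l => //; rewrite lee_fin ltW // w0.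
    by rewrite -EFinM lee_fin powE mulrAC.
  rewrite (iQ _ (tpV j)); have [h _] := en (iw j `^ dW) (powR_gt0 _ (tpV j)).
  apply: (@le_trans _ _ ((L * iw j `^ (- (delta * dW)))%:E * (C * iw j `^ dW)%:E)%E).
    by apply: lee_wpmul2l => //; rewrite lee_fin ltW // w0.
  rewrite -EFinM lee_fin.
  have -> : L * iw j `^ (- (delta * dW)) * (C * iw j `^ dW) =
      L * C * (iw j `^ (- (delta * dW)) * iw j `^ dW) by ring.
  rewrite -powRD; last by rewrite (gt_eqF (tpV j)) implybT.
  rewrite powR_inv ?tp // -/(pw j) powE (_ : - (- _ + _) = - ((1 - delta) * dW)) //; ring.
pose bound := L * C * ((1 - q1)^-1 + (1 - q2)^-1).
apply: le_lt_trans (ltry bound).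
apply: (@double_integral_le_limit _ _ _ mu sfmu Fn (fun z => G z)).
- by move=> n; apply: measurable_mine.
- by move=> n z; rewrite le_min G0 T0.
- move=> z n m nm; rewrite /Fn le_min ge_min lexx /= ge_min; apply/orP; right.
  rewrite /T -!(big_mkord xpredT (fun j => S j z)).
  by rewrite (big_cat_nat _ nm) //= leeDl // sume_ge0.
- move=> [x y]; have [j hj] : exists j, (G (x, y) <= S j (x, y))%E.
    have [xy|xy] := eqVneq x y.
      exists 0%N; rewrite {1}/G /= xy subrr normr0 powR0 ?gt_eqF // mul0r.
      exact: S0.
    have dxy : 0 < mdist x y by rewrite mdist_gt0.
    have [j [[h1 h2]|[h1 h2]]] := dyadic_scale dxy; exists j.
      by apply: (le_trans (G_le _ _ _ (tp j) h1 h2)); rewrite leeDl // Q0.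
    by apply: (le_trans (G_le _ _ _ (tpV j) h1 h2)); rewrite leeDr // Q0.
  apply: (@cvg_trans _ (cst (G (x, y)) n @[n --> \oo])); last exact: cvg_cst.
  apply: near_eq_cvg; near=> n; rewrite /Fn /= min_l //.
  have jn : (j < n)%N by near: n; exists j.+1.
  apply: le_trans hj _; rewrite /T (bigD1 (Ordinal jn)) //= leeDl //.
  by apply: sume_ge0 => i _.
move=> n; apply: (@le_trans _ _ (\int[mu]_x \int[mu]_y T n (x, y))%E).
  apply: ge0_le_integral_lower => x _.
    by apply: integral_ge0 => y _; rewrite le_min G0 T0.
  apply: ge0_le_integral_lower => y _; first by rewrite le_min G0 T0.
  by rewrite ge_min lexx orbT.
have -> : (\int[mu]_x \int[mu]_y T n (x, y) = \sum_(j < n) \int[mu]_x \int[mu]_y S j (x, y))%E.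
  rewrite -ge0_integral_sum //; first last.
  - by move=> j x _; apply: integral_ge0.
  - by move=> j; exact: (measurable_integral_section sfmu).
  apply: eq_integral => x _; rewrite -ge0_integral_sum //.
  by move=> j; exact: (measurable_fun_pair2 x (mS j)).
apply: (@le_trans _ _ (\sum_(j < n) (L * C * (q1 ^+ j + q2 ^+ j))%:E)%E).
  by apply: lee_sum => j _; exact: S_le.
rewrite sumEFin lee_fin -mulr_sumr big_split /= /bound (ler_pM2l (mulr_gt0 L0 C0)).
by apply: lerD; apply: geometric_sum_le; rewrite ?powR_ge0.
Unshelve. all: by end_near. Qed.

End dyadic.

(** * Truncation and the density theorem *)

Section truncation.
Context d (T : measurableType d) (R : realType).
Variable mu : {measure set T -> \bar R}.
Variable B : nat -> set T.
Hypothesis mB : forall n, measurable (B n).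
Hypothesis B_nd : {homo B : n m / (n <= m)%N >-> n `<=` m}.
Hypothesis B_cover : \bigcup_n B n = setT.

(** Cutting off both the values and the support makes the function square
integrable as well. *)
Definition truncation (n : nat) (g : T -> R) (x : T) : R :=
  \1_(B n) x * Num.min (Num.max (g x) (- n%:R)) n%:R.

Lemma measurable_truncation n g : measurable_fun setT g -> measurable_fun setT (truncation n g).
Proof.
move=> mg; apply: measurable_funM; first exact: measurable_indic.
by apply: measurable_minr => //; exact: measurable_maxr.
Qed.

Lemma truncation_bound n g x : `|truncation n g x| <= n%:R * \1_(B n) x.
Proof.
have i0 : 0 <= \1_(B n) x :> R by rewrite indicE.
rewrite /truncation normrM mulrC (ger0_norm i0); apply: ler_wpM2r => //.
rewrite ler_norml.
have n0 : 0 <= n%:R :> R by [].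
by rewrite le_min le_max lexx orbT ge_min lexx orbT andbT; lra.
Qed.

Lemma truncation_diff n g x : `|g x - truncation n g x| <= `|g x|.
Proof.
rewrite /truncation indicE; case: (_ \in _); last by rewrite mul0r subr0.
have n0 : 0 <= n%:R :> R by [].
rewrite mul1r; move: (n%:R : R) n0 => m n0.
case: (leP (g x) (- m)) => h1.
  rewrite min_l; last lra.
  by rewrite !ler0_norm; lra.
case: (leP (g x) m) => h2; first by rewrite subrr normr0.
by rewrite !ger0_norm; lra.
Qed.

Lemma truncation_eventually g x : \forall n \near \oo, truncation n g x = g x.
Proof.
have : (\bigcup_n B n) x by rewrite B_cover.
case=> N _ BNx; exists (maxn N (Num.truncn `|g x|).+1) => // n /=.
rewrite geq_max => /andP[Nn gn]; rewrite /truncation indicE mem_set; last exact: B_nd Nn _ BNx.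
have : `|g x| <= n%:R.
  apply: (@le_trans _ _ (Num.truncn `|g x|).+1%:R); last by rewrite ler_nat.
  by apply: ltW; exact: real_truncnS_gt (num_real _).
by rewrite ler_norml mul1r => /andP[h1 h2]; rewrite max_l // min_l.
Qed.

Lemma truncation_Lp_dense (p : R) g (c : R) : 0 < p -> 0 < c -> g \in Lfun mu p%:E ->
  exists n, (\int[mu]_x (`|g x - truncation n g x| `^ p)%:E <= c%:E)%E.
Proof.
move=> p0 c0 gp; have mg := Lfun_measurable gp.
have gfin := (mem_LfunP mu p0 mg).1 gp.
pose f_ n x := (`|g x - truncation n g x| `^ p)%:E.
have mf n : measurable_fun setT (f_ n).
  apply/measurable_EFinP; apply: (measurableT_comp (measurable_powR _)).
  by apply: measurableT_comp => //; apply: measurable_funB => //; exact: measurable_truncation.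
have ig : mu.-integrable setT (fun x => (`|g x| `^ p)%:E).
  apply/integrableP; split.
    apply/measurable_EFinP; apply: (measurableT_comp (measurable_powR _)).
    exact: measurableT_comp.
  rewrite (eq_integral (fun x => (`|g x| `^ p)%:E)) // => x _.
  by rewrite gee0_abs // lee_fin powR_ge0.
have [|||_ _ hc] := @dominated_convergence _ _ _ mu setT measurableT f_ (cst 0%E) _ mf _ _ ig.
- by [].
- apply: nearW => x _; apply: (@cvg_trans _ (cst (0 : \bar R) n @[n --> \oo])); last exact: cvg_cst.
  apply: near_eq_cvg; near=> n; rewrite /f_ (_ : truncation n g x = g x).
    by rewrite subrr normr0 powR0 // gt_eqF.
  by near: n; exact: truncation_eventually.
- apply: nearW => x n _; rewrite /f_ gee0_abs ?lee_fin ?powR_ge0 //.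
  apply: ge0_ler_powR; rewrite ?nnegrE //; [exact: ltW|exact: truncation_diff].
move: hc; rewrite integral0 => /fine_cvgP[fin /cvgrPdist_lt /(_ c c0) small].
have [n [h1 h2]] := filter_ex (filterI fin small).
exists n; move: h1 h2 => /= h1; rewrite sub0r normrN => /(le_lt_trans (ler_norm _)) h2.
by rewrite -(fineK h1) lee_fin ltW.
Unshelve. all: by end_near. Qed.

Lemma Lnorm_le_powR (p c : R) (q : T -> R) : 0 < p -> 0 <= c ->
  (\int[mu]_x (`|q x| `^ p)%:E <= (c `^ p)%:E)%E -> ('N[mu]_p%:E[EFin \o q] <= c%:E)%E.
Proof.
move=> p0 c0 h; have -> : c%:E = ((c `^ p)%:E `^ p^-1)%E.
  by rewrite poweR_EFin -powRrM mulfV ?gt_eqF // powRr1.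
rewrite unlock; apply: gt0_ler_poweR; first by rewrite invr_ge0 ltW.
- by rewrite in_itv /= leey andbT integral_ge0.
- by rewrite in_itv /= leey andbT lee_fin powR_ge0.
exact: h.
Qed.

End truncation.

(** Regularity does not provide a point, hence the separate case of an empty space. *)
Lemma ball_exhaustion (d : measure_display) (R : realType) (X : borelMetricType d R)
    (mu : {measure set X -> \bar R}) (dH : R) : ahlfors_regular mu dH ->
  exists B : nat -> set X, [/\ forall n, measurable (B n), forall n, (mu (B n) < +oo)%E,
    {homo B : n m / (n <= m)%N >-> n `<=` m} & \bigcup_n B n = setT].
Proof.
case=> _ [c1 [c2 [_ _ hv]]]; have [[x0 _]|noX] := pselect (exists x : X, True).
  exists (fun n => ball x0 n%:R); split.
  - by move=> n; exact: ball_borel.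
  - move=> n; have /andP[_ h] := hv x0 n%:R (ler0n _ _).
    exact: le_lt_trans h (ltry _).
  - move=> n m nm; apply: le_ball; by rewrite ler_nat.
  - apply/seteqP; split=> // x _; exists (Num.truncn (mdist x0 x)).+1 => //.
    rewrite ballEmdist /=; exact: real_truncnS_gt (num_real _).
exists (fun=> set0); split.
- by move=> n; exact: measurable0.
- by move=> n; rewrite measure0.
- by move=> n m _ x.
- by apply/seteqP; split=> // x; exfalso; apply: noX; exists x.
Qed.

Theorem corollary5p4 (d : measure_display) (R : realType)
  (X : borelMetricType d R) (mu : {measure set X -> \bar R})
  (E : (X -> R) -> (X -> R) -> R) (F : set (X -> R))
  (P : R -> (X -> R) -> (X -> R)) (pt : R -> X -> X -> R)
  (dH dW kappa delta : R) (eta : R -> R -> R) (p : R)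
  (X_locally_compact : locally_compact [set: X])
  (mu_radon : radon mu) (mu_support : full_support mu)
  (EF_dirichlet : dirichlet_form mu E F)
  (P_heat : heat_semigroup mu E F P)
  (A1 : forall (x : X) (r : R), compact (closure (ball x r)))
  (A2 : ahlfors_regular mu dH)
  (A3 : regular_form mu E F /\ strongly_local_form mu E F)
  (HK : continuous_heat_kernel mu pt P /\ sub_gaussian_bounds mu pt dH dW)
  (BE : weak_bakry_emery mu pt dW kappa)
  (delta_gt0 : 0 < delta) (delta_lt1 : delta < 1)
  (eta_density : stable_subordinator_density delta eta)
  (p_ge2 : 2 <= p) :
  besov mu pt eta p p^-1 = sobolev mu dH (delta * dW / p) p /\
  Lp_dense mu p (besov mu pt eta p p^-1).
Proof.
have [hk_cont pt_bounds] := HK.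
have pt_continuous (t : R) : 0 < t -> continuous (fun z : X * X => pt t z.1 z.2).
  by move=> /hk_cont[].
have P_kernel (t : R) f : 0 < t -> f \in Lfun mu 2%:E ->
    P t f = kernel_op mu pt t f %[ae mu] by move=> /hk_cont[_]; exact.
have [B [mB B_fin B_nd B_cover]] := ball_exhaustion A2.
have sfmu : sigma_finite setT mu by exists B => // n; split.
have dH_gt0 : 0 < dH by case: A2.
have dW_gt1 : 1 < dW by have [dW2 _] := pt_bounds; apply: lt_le_trans dW2; rewrite ltr1n.
have p_gt0 : 0 < p by exact: lt_le_trans p_ge2.
have eqBW : besov mu pt eta p p^-1 = sobolev mu dH (delta * dW / p) p.
  exact: (besov_eq_sobolev A1 mu_support sfmu dH_gt0 pt_continuous pt_bounds).
split=> //; rewrite eqBW.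
have pt_ge0 (t : R) x y : 0 < t -> 0 <= pt t x y.
  exact: (heat_kernel_ge0 mu_support pt_continuous pt_bounds).
have [c3 [c4 [c5 [c6 [c30 c40 c50 c60 hk]]]]] :=
  sub_gaussian_everywhere mu_support pt_continuous pt_bounds.
have pt_bounded (t : R) : 0 < t -> forall x, exists M : R, forall y, pt t x y <= M.
  move=> t0 x; exists (c3 * t `^ (- (dH / dW)) + pt t x x) => y.
  have [->|xy] := eqVneq x y; first by rewrite lerDr mulr_ge0 ?powR_ge0 // ltW.
  apply: (@le_trans _ _ (c3 * t `^ (- (dH / dW)))); last by rewrite lerDl pt_ge0.
  have [_ h] := hk t x y t0 xy; apply: le_trans h _; rewrite ler_pM2l //.
  rewrite /stretched -[leRHS]mulr1 ler_wpM2l ?powR_ge0 //.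
  by rewrite -expR0 ler_expR oppr_le0 mulr_ge0 ?powR_ge0 // ltW.
move=> g gp e e0; have mg := Lfun_measurable gp.
have e4 : 0 < e / 4 by rewrite divr_gt0.
have [n hn] := truncation_Lp_dense mB B_nd B_cover p_gt0 (powR_gt0 p e4) gp.
pose f := truncation B n g; have mf : measurable_fun setT f by exact: measurable_truncation.
pose M : R := n.+1%:R; have M0 : 0 < M by rewrite ltr0n.
have f_bnd x : `|f x| <= M * \1_(B n) x.
  apply: le_trans (truncation_bound B n g x) _.
  by rewrite ler_wpM2r // ?indicE // ler_nat.
have ind01 x : 0 <= (\1_(B n) x : R) <= 1 by rewrite indicE; case: (_ \in _); rewrite ?lexx ?ler01.
have fM x : `|f x| <= M.
  apply: le_trans (f_bnd x) _; rewrite -[leRHS]mulr1 ler_pM2l //; by case/andP: (ind01 x).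
have chi2 := indic_L2 (mB n) (B_fin n).
have f2 : f \in Lfun mu 2%:E.
  apply: (L2_le mf (L2_scale M chi2)) => x; apply: le_trans (f_bnd x) (ler_norm _).
(* the Markov property concerns values in [[0, M]], so [f] is split into its
   positive and negative parts *)
pose fp x := Num.max (f x) 0; pose fn x := Num.max (- f x) 0.
have mfp : measurable_fun setT fp by exact: measurable_maxr.
have mfn : measurable_fun setT fn.
  by apply: measurable_maxr => //; exact: measurableT_comp.
have fpn x : [/\ 0 <= fp x, 0 <= fn x, fp x <= `|f x|, fn x <= `|f x| & f x = fp x - fn x].
  rewrite /fp /fn; have /orP[h|h] := le_total 0 (f x).
    have -> : Num.max (f x) 0 = f x by exact: max_l.
    have -> : Num.max (- f x) 0 = 0 by apply: max_r; rewrite oppr_le0.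
    by rewrite ger0_norm // subr0; split.
  have -> : Num.max (f x) 0 = 0 by exact: max_r.
  have -> : Num.max (- f x) 0 = - f x by apply: max_l; rewrite oppr_ge0.
  by rewrite ler0_norm // sub0r opprK; split; rewrite ?oppr_ge0.
have fp2 : fp \in Lfun mu 2%:E.
  by apply: (L2_le mfp f2) => x; have [h1 _ h2 _ _] := fpn x; rewrite ger0_norm.
have fn2 : fn \in Lfun mu 2%:E.
  by apply: (L2_le mfn f2) => x; have [_ h1 _ h2 _] := fpn x; rewrite ger0_norm.
pose K := (2 * M) `^ (p - 2); have K0 : 0 < K by rewrite powR_gt0 // mulr_gt0.
(* an [L^2] error [e'] becomes an [L^p] error of at most [e / 4] *)
pose e' := Num.sqrt ((e / 4) `^ p / K).
have eK0 : 0 < (e / 4) `^ p / K by rewrite divr_gt0 // powR_gt0.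
have e'0 : 0 < e' by rewrite sqrtr_gt0.
have [h h0 hh] := resolvent_dense EF_dirichlet e'0 f2.
have [u1 hu1 u1M] := resolvent_markov EF_dirichlet h0 M0 fp2 (f := fp)
   (fun x => let: And5 a _ b _ _ := fpn x in introT andP (conj a (le_trans b (fM x)))).
have [u2 hu2 u2M] := resolvent_markov EF_dirichlet h0 M0 fn2 (f := fn)
   (fun x => let: And5 _ a _ b _ := fpn x in introT andP (conj a (le_trans b (fM x)))).
pose u x := - 1 * u2 x + u1 x.
have hu : resolvent_eq mu E F h f u.
  have := resolvent_lin EF_dirichlet (- 1) fn2 fp2 hu2 hu1.
  rewrite (_ : (fun x => - 1 * fn x + fp x) = f) //; apply/funext => x.
  by have [_ _ _ _ ->] := fpn x; rewrite mulN1r addrC.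
have uM x : `|u x| <= M.
  rewrite /u mulN1r ler_norml; have /andP[a1 a2] := u1M x; have /andP[b1 b2] := u2M x.
  by apply/andP; split; lra.
have uF : F u by case: hu.
have uL2 := form_domain_L2 EF_dirichlet uF; have mu_u := Lfun_measurable uL2.
have Lp_le_L2 (q : X -> R) : q \in Lfun mu 2%:E -> (forall x, `|q x| <= 2 * M) ->
    (\int[mu]_x (`|q x| `^ p)%:E <= (K * inner2 mu q q)%:E)%E.
  move=> q2 qM; rewrite EFinM -inner2E // -ge0_integralZl_lower //; last first.
    by move=> x _; rewrite lee_fin -expr2 sqr_ge0.
  apply: ge0_le_integral_lower => x _; first by rewrite lee_fin powR_ge0.
  rewrite -EFinM lee_fin -expr2 -(real_normK (num_real (q x))).
  exact: powR_le_sqr.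
have M2 : M <= 2 * M by lra.
have up : u \in Lfun mu p%:E.
  apply/(mem_LfunP mu p_gt0 mu_u); apply: le_lt_trans (Lp_le_L2 u uL2 _) (ltry _).
  by move=> x; exact: le_trans (uM x) M2.
exists u.
  split=> //; apply/(sobolev_seminorm_lty mu dH dW delta p_ge2).
  have gu := resolvent_generator EF_dirichlet h0 f2 hu.
  have [C C0 hC] := generator_energy_le EF_dirichlet P_heat A1 pt_continuous pt_ge0
    pt_bounded P_kernel mB B_fin B_nd B_cover gu uM.
  apply: (bounded_energy_sobolev sfmu A1 pt_continuous pt_ge0 c50 c60 _ dH_gt0 dW_gt1
    delta_gt0 delta_lt1 p_ge2 M0 C0 mu_u uM hC).
  by move=> t x y t0 xy; have [] := hk t x y t0 xy.
have fu2 := L2_sub f2 uL2.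
have n1 : ('N[mu]_p%:E[EFin \o (g \- f)%R] <= (e / 4)%:E)%E.
  exact: (Lnorm_le_powR p_gt0 (ltW e4)).
have n2 : ('N[mu]_p%:E[EFin \o (f \- u)%R] <= (e / 4)%:E)%E.
  apply: (Lnorm_le_powR p_gt0 (ltW e4)).
  apply: le_trans (Lp_le_L2 (f \- u) fu2 _) _.
    by move=> x; apply: le_trans (ler_normB _ _) _; have := fM x; have := uM x; lra.
  rewrite lee_fin -L2norm_sqr L2norm_subC.
  apply: (@le_trans _ _ (K * e' ^+ 2)).
    by rewrite ler_pM2l // lerXn2r ?nnegrE ?L2norm_ge0 ?(ltW e'0) //; exact: hh.
  by rewrite sqr_sqrtr ?(ltW eK0) // mulrC divfK // gt_eqF.
have -> : (g \- u)%R = (g \- f) \+ (f \- u) by apply/funext => x /=; rewrite addrA subrK.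
apply: le_lt_trans (minkowski_EFin mu _ _ _) _.
- exact: measurable_funB.
- exact: measurable_funB.
- by apply: le_trans p_ge2; rewrite ler1n.
apply: le_lt_trans (leeD n1 n2) _.
by rewrite -EFinD lte_fin; lra.
Qed.
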